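(* Let $f=\frac1n\sum_{i=1}^n f_i:\mathbb{R}^d\to\mathbb{R}$ be convex, $\mu$-quasi strongly convex with $\mu\ge 0$ (with unique minimizer $x^*$) and $L$-smooth. Consider the iterates $x^k$ of EC-SGD run with stepsize $\gamma$ and an absolute compression operator $\mathcal{C}$ with constant $\Delta\ge 0$, and suppose that the Key Parametric Assumption holds with parameters $A,B,C,D_1,D_2\ge 0$, $\rho\in(0,1]$ and a sequence $\{\sigma_k^2\}_{k\ge0}$. Let $F=\frac{4B}{3\rho}$ and assume $$0<\gamma\le \frac{1}{4(A+CF)} .$$ Define $\eta=\min\{\frac{\gamma\mu}{2},\frac{\rho}{4}\}$, $w_k=(1-\eta)^{-(k+1)}$, $W_K=\sum_{k=0}^K w_k$, $\overline{x}^K=\frac{1}{W_K}\sum_{k=0}^K w_k x^k$ and $T_0=\|x^0-x^*\|^2+F\gamma^2\sigma_0^2$. Then for all $K\ge 0$: $$\mathbb{E}\left[f(\overline{x}^K)-f(x^* )\right]\le (1-\eta)^{K+1}\,\frac{2\,\mathbb{E}[T_0]}{\gamma}+2\gamma\left(D_1+FD_2+3L\gamma\Delta^2\right)\quad\text{if }\mu>0,$$ $$\mathbb{E}\left[f(\overline{x}^K)-f(x^* )\right]\le \frac{2\,\mathbb{E}[T_0]}{\gamma(K+1)}+2\gamma\left(D_1+FD_2+3L\gamma\Delta^2\right)\quad\text{if }\mu=0.$$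
   Context: Problem: minimize $f(x)=\frac1n\sum_{i=1}^n f_i(x)$ over $x\in\mathbb{R}^d$, where $f_1,\dots,f_n:\mathbb{R}^d\to\mathbb{R}$ are differentiable; the minimizer $x^*$ of $f$ is unique. $f$ is $\mu$-quasi strongly convex ($\mu\ge0$) if $f(x^* )\ge f(x)+\langle\nabla f(x),x^*-x\rangle+\frac{\mu}{2}\|x-x^*\|^2$ for all $x\in\mathbb{R}^d$. $f$ is $L$-smooth if $\|\nabla f(x)-\nabla f(y)\|\le L\|x-y\|$ for all $x,y\in\mathbb{R}^d$. Absolute compression operator: a (possibly stochastic) map $\mathcal{C}:\mathbb{R}^d\to\mathbb{R}^d$ for which there is $\Delta\ge0$ with $\mathbb{E}[\|\mathcal{C}(x)-x\|^2]\le\Delta^2$ for all $x\in\mathbb{R}^d$. If $\mathcal{C}$ is stochastic, each application uses fresh randomness, so the bound holds conditionally on the argument. EC-SGD: given $x^0\in\mathbb{R}^d$ and stepsize $\gamma>0$, set $e_i^0=0$ for $i=1,\dots,n$. For $k=0,1,2,\dots$, each worker $i$ computes a stochastic gradient $g_i^k$, sets $v_i^k=\gamma\,\mathcal{C}\!\left(\frac{e_i^k+\gamma g_i^k}{\gamma}\right)$ and $e_i^{k+1}=e_i^k+\gamma g_i^k-v_i^k$; then $x^{k+1}=x^k-v^k$ with $v^k=\frac1n\sum_{i=1}^n v_i^k$. Key Parametric Assumption: let $g^k=\frac1n\sum_{i=1}^n g_i^k$ and let $\mathbb{E}_k[\cdot]$ denote expectation with respect to the randomness coming from iteration $k$ (i.e.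 conditional on everything before iteration $k$). For all $k\ge0$, $\mathbb{E}_k[g^k]=\nabla f(x^k)$. Moreover there exist $A,B,C,D_1,D_2\ge0$, $\rho\in(0,1]$ and a sequence of (possibly random) variables $\{\sigma_k^2\}_{k\ge0}$ (nonnegative) such that for all $k\ge0$ $$\mathbb{E}_k[\|g^k\|^2]\le 2A(f(x^k)-f(x^* ))+B\sigma_k^2+D_1,$$ $$\mathbb{E}_k[\sigma_{k+1}^2]\le(1-\rho)\sigma_k^2+2C(f(x^k)-f(x^* ))+D_2.$$ *)

(* Defs.v *)
From HB Require Import structures.
From mathcomp Require Import all_boot all_order all_algebra.
From mathcomp Require Import all_classical all_reals all_analysis.
From mathcomp Require Import measurable_realfun.
Import Order.TTheory GRing.Theory Num.Theory.
Import numFieldNormedType.Exports.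

Set Implicit Arguments.
Unset Strict Implicit.
Unset Printing Implicit Defensive.

Local Open Scope classical_set_scope.
Local Open Scope ring_scope.

(* R^d with its Borel sigma-algebra; the library puts no measurable
   structure on row vectors. *)
Notation borel_rV R d := (g_sigma_algebraType (@open 'rV[R]_d)).

Section Euclidean.
Context {R : realType} {d : nat}.
Implicit Types (x y : 'rV[R]_d) (f : 'rV[R]_d -> R).

Definition dotv x y : R := \sum_j x 0 j * y 0 j.

(* The norm that the library puts on 'rV[R]_d is the sup norm. *)
Definition enorm x : R := Num.sqrt (dotv x x).

Definition gradient f x : 'rV[R]_d := \row_j 'D_(delta_mx 0 j) f x.

Definition is_unique_minimizer f xs :=
  (forall x, f xs <= f x) /\ (forall y, (forall x, f y <= f x) -> y = xs).

Definition quasi_strongly_convex mu f xs :=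
  forall x, f xs >= f x + dotv (gradient f x) (xs - x)
                    + mu / 2 * enorm (x - xs) ^+ 2.

(* [0 <= L] follows from the inequality except when d = 0. *)
Definition smooth L f :=
  0 <= L /\
  forall x y, enorm (gradient f x - gradient f y) <= L * enorm (x - y).

End Euclidean.

Definition average {R : realType} {n : nat} {V : lmodType R} (v : 'I_n -> V) : V :=
  n%:R^-1 *: \sum_i v i.

Definition avg_fun {R : realType} {n d : nat} (f_ : 'I_n -> 'rV[R]_d -> R)
    (x : 'rV[R]_d) : R := n%:R^-1 * \sum_i f_ i x.

Section Probability.
Context {dT : measure_display} {T : measurableType dT} {R : realType}.
Variable P : probability T R.

Definition measurable_wrt (G : set (set T)) {dU : measure_display}
    {U : measurableType dU} (X : T -> U) :=
  forall B : set U, measurable B -> G (X @^-1` B).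

Definition filtration (Fk : nat -> set (set T)) :=
  forall k, [/\ sigma_algebra setT (Fk k), Fk k `<=` measurable
              & Fk k `<=` Fk k.+1].

(* Y is a version of the conditional expectation E[X | G]. A nonnegative X need
   not be integrable. *)
Definition is_condexp (G : set (set T)) (X Y : T -> \bar R) :=
  [/\ measurable_fun [set: T] X,
      (forall w, (0 <= X w)%E) \/ P.-integrable [set: T] X,
      measurable_wrt G Y
    & forall A, G A -> (\int[P]_(w in A) X w = \int[P]_(w in A) Y w)%E].

(* E[X | G] <= Z almost surely; versions of E[X | G] agree almost surely. *)
Definition condexp_le (G : set (set T)) (X Z : T -> R) :=
  exists2 Y, is_condexp G (EFin \o X) Y & {ae P, forall w, (Y w <= (Z w)%:E)%E}.

Definition indep_rv {dU dV : measure_display} {U : measurableType dU}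
    {V : measurableType dV} (X : T -> U) (Y : T -> V) :=
  forall A B, measurable A -> measurable B ->
    P (X @^-1` A `&` Y @^-1` B) = (P (X @^-1` A) * P (Y @^-1` B))%E.

End Probability.

(* A stochastic map on R^d is given as comp s x, with s drawn from the law Q;
   a deterministic one is the case where comp ignores s. *)
Definition absolute_compressor {R : realType} {d : nat} {dS : measure_display}
    {S : measurableType dS} (Q : probability S R)
    (comp : S -> 'rV[R]_d -> 'rV[R]_d) (Delta : R) :=
  [/\ 0 <= Delta,
      measurable_fun [set: S * borel_rV R d]
        (fun p => comp p.1 p.2 : borel_rV R d)
    & forall x, ('E_Q[fun s => enorm (comp s x - x) ^+ 2]%R <= (Delta ^+ 2)%:E)%E].

Section ECSGD.
Context {R : realType} {n d : nat} {dT dS : measure_display}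
  {T : measurableType dT} {S : measurableType dS}.
Variables (comp : S -> 'rV[R]_d -> 'rV[R]_d) (gamma : R) (x0 : 'rV[R]_d).
(* g k i is the stochastic gradient of worker i at iteration k, and xi k i the
   seed of its compression. *)
Variables (g : nat -> 'I_n -> T -> 'rV[R]_d) (xi : nat -> 'I_n -> T -> S).

Definition ec_message s (e h : 'rV[R]_d) : 'rV[R]_d :=
  gamma *: comp s (gamma^-1 *: (e + gamma *: h)).

Fixpoint ec_error k i w : 'rV[R]_d :=
  if k is k'.+1 then
    let e := ec_error k' i w in
    e + gamma *: g k' i w - ec_message (xi k' i w) e (g k' i w)
  else 0.

Definition ec_arg k i w : 'rV[R]_d :=
  gamma^-1 *: (ec_error k i w + gamma *: g k i w).

Fixpoint ec_iter k w : 'rV[R]_d :=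
  if k is k'.+1 then
    ec_iter k' w
    - average (fun i => ec_message (xi k' i w) (ec_error k' i w) (g k' i w))
  else x0.

Definition mean_grad k w : 'rV[R]_d := average (fun i => g k i w).

(* Fk k is the information available before iteration k. Fresh randomness is
   used only through the independence of each seed from the vector that is
   being compressed. *)
Record ec_sgd_randomness (P : probability T R) (Q : probability S R)
    (Fk : nat -> set (set T)) : Prop := {
  ec_filtration : filtration Fk ;
  ec_grad_adapted :
    forall k i, measurable_wrt (Fk k.+1) (g k i : T -> borel_rV R d) ;
  ec_seed_adapted : forall k i, measurable_wrt (Fk k.+1) (xi k i) ;
  ec_seed_law : forall k i B, measurable B -> P (xi k i @^-1` B) = Q B ;
  ec_seed_fresh :
    forall k i, indep_rv P (ec_arg k i : T -> borel_rV R d) (xi k i)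
}.

End ECSGD.

Record key_parametric_assumption {R : realType} {d : nat}
    {dT : measure_display} {T : measurableType dT} (P : probability T R)
    (Fk : nat -> set (set T)) (f : 'rV[R]_d -> R) (xs : 'rV[R]_d)
    (x gbar : nat -> T -> 'rV[R]_d) (sigma2 : nat -> T -> R)
    (A B C D1 D2 rho : R) : Prop := {
  kpa_A : 0 <= A ;
  kpa_B : 0 <= B ;
  kpa_C : 0 <= C ;
  kpa_D1 : 0 <= D1 ;
  kpa_D2 : 0 <= D2 ;
  kpa_rho : 0 < rho <= 1 ;
  kpa_sigma2_ge0 : forall k w, 0 <= sigma2 k w ;
  kpa_sigma2_adapted : forall k, measurable_wrt (Fk k) (sigma2 k) ;
  kpa_unbiased : forall k j,
    is_condexp P (Fk k) (fun w => (gbar k w 0 j)%:E)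
                        (fun w => (gradient f (x k w) 0 j)%:E) ;
  kpa_second_moment : forall k,
    condexp_le P (Fk k) (fun w => enorm (gbar k w) ^+ 2)
      (fun w => 2 * A * (f (x k w) - f xs) + B * sigma2 k w + D1) ;
  kpa_sigma2_rec : forall k,
    condexp_le P (Fk k) (sigma2 k.+1)
      (fun w => (1 - rho) * sigma2 k w + 2 * C * (f (x k w) - f xs) + D2)
}.

Definition weight {R : realType} (eta : R) (k : nat) : R := (1 - eta) ^- k.+1.

Definition weighted_average {R : realType} {V : lmodType R} (eta : R)
    (x : nat -> V) (K : nat) : V :=
  (\sum_(k < K.+1) weight eta k)^-1 *: \sum_(k < K.+1) weight eta k *: x k.

(* Main.v *)
(* Let e^k be the mean of the workers' errors.  The virtual iterates
   z^k = x^k - e^k obey the uncompressed recursion z^{k+1} = z^k - gamma g^k.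
   Expanding |z^{k+1} - x*|^2, replacing g^k by grad f(x^k) in the cross term
   (z^k is measurable before iteration k) and using quasi-strong convexity
   together with 2 <grad f(x), e> <= f(x) - f* + 2 L |e|^2, which is the descent
   lemma applied at x - 2e, shows that
   T_k = E |z^k - x*|^2 + F gamma^2 E sigma_k^2 satisfies
     T_{k+1} <= (1 - eta) T_k - (gamma / 2) E (f(x^k) - f* )
                + gamma^2 (D1 + F D2 + 3 L gamma Delta^2),
   where E |e^k|^2 <= gamma^2 Delta^2 comes from the compressor and mu <= L from
   comparing the growth of f along rays.  Weighting by w_k, telescoping and
   Jensen's inequality conclude.  All these expectations are finite as soon as
   E T_0 is; otherwise the right-hand sides are +oo. *)

Require Import Defs.
From HB Require Import structures.
From mathcomp Require Import all_boot all_order all_algebra.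
From mathcomp Require Import all_classical all_reals all_analysis.
From mathcomp Require Import measurable_realfun.
From mathcomp Require Import ring lra.
Import Order.TTheory GRing.Theory Num.Theory.
Import numFieldNormedType.Exports.

Set Implicit Arguments.
Unset Strict Implicit.
Unset Printing Implicit Defensive.

Local Open Scope classical_set_scope.
Local Open Scope ring_scope.

(** * Euclidean geometry and smooth functions *)

Section dot.
Context {R : realType} {d : nat}.
Implicit Types (x y z v : 'rV[R]_d) (f : 'rV[R]_d -> R).

Lemma dotvC x y : dotv x y = dotv y x.
Proof. by apply: eq_bigr => j _; rewrite mulrC. Qed.

Lemma dotvDl x y z : dotv (x + y) z = dotv x z + dotv y z.
Proof. by rewrite -big_split; apply: eq_bigr => j _; rewrite mxE mulrDl. Qed.

Lemma dotvZl a x y : dotv (a *: x) y = a * dotv x y.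
Proof. by rewrite mulr_sumr; apply: eq_bigr => j _; rewrite mxE mulrA. Qed.

Lemma dotvNl x y : dotv (- x) y = - dotv x y.
Proof. by rewrite -scaleN1r dotvZl mulN1r. Qed.

Lemma dotvDr x y z : dotv z (x + y) = dotv z x + dotv z y.
Proof. by rewrite dotvC dotvDl !(dotvC z). Qed.

Lemma dotvZr a x y : dotv y (a *: x) = a * dotv y x.
Proof. by rewrite dotvC dotvZl dotvC. Qed.

Lemma dotvNr x y : dotv y (- x) = - dotv y x.
Proof. by rewrite dotvC dotvNl dotvC. Qed.

Definition dotvE := (dotvDl, dotvDr, dotvNl, dotvNr, dotvZl, dotvZr).

Lemma dotvv_ge0 x : 0 <= dotv x x.
Proof. by apply: sumr_ge0 => j _; rewrite -expr2 sqr_ge0. Qed.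

Lemma dotvBB x y :
  dotv (x - y) (x - y) = dotv x x - 2 * dotv x y + dotv y y.
Proof. by rewrite !dotvE (dotvC y x); ring. Qed.

Lemma dotvDD_le x y : dotv (x + y) (x + y) <= 2 * dotv x x + 2 * dotv y y.
Proof. by have := dotvv_ge0 (x - y); rewrite !dotvE (dotvC y x); lra. Qed.

Lemma enorm_sqr x : enorm x ^+ 2 = dotv x x.
Proof. by rewrite sqr_sqrtr // dotvv_ge0. Qed.

Lemma enorm_ge0 x : 0 <= enorm x.
Proof. exact: sqrtr_ge0. Qed.

(** Cauchy-Schwarz. If |y| > 0, expand the squared norm of |y|^2 x - <x,y> y, a multiple of the
    component of [x] orthogonal to [y]; it equals |y|^2 (|x|^2 |y|^2 - <x,y>^2). *)
Lemma dotv_le_enorm x y : dotv x y <= enorm x * enorm y.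
Proof.
apply: le_trans (ler_norm _) _.
rewrite -ler_sqr ?nnegrE ?mulr_ge0 ?enorm_ge0 // real_normK ?num_real //.
rewrite exprMn !enorm_sqr.
have := dotvv_ge0 (dotv y y *: x - dotv x y *: y).
(* This settles the case [dotv y y = 0]: were <x,y> nonzero, the square would equal |x|^2 - 2 (|x|^2
   + 1) < 0. *)
have := dotvv_ge0 (x - ((dotv x x + 1) / dotv x y) *: y).
rewrite !dotvE (dotvC y x); have := dotvv_ge0 y; have := dotvv_ge0 x.
move: (dotv x x) (dotv y y) (dotv x y) => a b c a0 b0.
have [->|bn0] := eqVneq b 0; last first.
  have {}b0 : 0 < b by rewrite lt_def bn0.
  move=> _ h; have : 0 <= b * (a * b - c ^+ 2) by lra.
  by rewrite pmulr_rge0 // subr_ge0.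
have [->|c0] := eqVneq c 0; first by move=> *; rewrite expr0n mulr0.
have h : (a + 1) / c * c = a + 1 by rewrite divfK.
by nra.
Qed.
End dot.

Section smooth_functions.
Context {R : realType} {d : nat}.
Implicit Types (L mu : R) (x y z v e xs : 'rV[R]_d) (f : 'rV[R]_d -> R).

Lemma derive_gradient f x v : differentiable f x ->
  'D_v f x = dotv (gradient f x) v.
Proof.
move=> df; rewrite deriveE // [in LHS](row_sum_delta v) linear_sum.
apply: eq_bigr => j _; rewrite linearZ /= mxE deriveE // mulrC //.
Qed.

Lemma is_derive_line f x v (t : R) : (forall y, differentiable f y) ->
  is_derive t 1 (fun s => f (x + s *: v)) (dotv (gradient f (x + t *: v)) v).
Proof.
move=> df; set h := fun s => _.
(* The two difference quotients are the same function of [r], so both derivability and the value of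
   the derivative carry over. *)
have eqq : (fun r : R => r^-1 *: ((h \o shift t) (r *: (1 : R^o)) - h t)) =
    (fun r : R => r^-1 *: ((f \o shift (x + t *: v)) (r *: v) - f (x + t *: v))).
  apply/funext => r; rewrite /h /=.
  by rewrite scaler1 scalerDl addrCA addrA.
have dv : derivable f (x + t *: v) v by exact: diff_derivable.
apply: DeriveDef; first by rewrite /derivable eqq.
by rewrite -derive_gradient // /derive eqq.
Qed.

(** The mean value theorem replaces the usual integral: [h] is [f] along the segment minus the
    claimed quadratic upper model, up to a constant. Its derivative is nonpositive on ]0,1[ by
    Cauchy-Schwarz and the Lipschitz bound, so h(1) <= h(0). *)
Lemma descent_lemma L f x v : (forall y, differentiable f y) -> smooth L f ->
  f (x + v) <= f x + dotv (gradient f x) v + L / 2 * dotv v v.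
Proof.
move=> df [L0 sm].
pose h (t : R) :=
  f (x + t *: v) - t * dotv (gradient f x) v - t ^+ 2 * (L / 2 * dotv v v).
pose h' (t : R) :=
  dotv (gradient f (x + t *: v)) v - dotv (gradient f x) v - t * (L * dotv v v).
have dh (t : R) : is_derive t (1 : R) h (h' t).
  have := is_derive_line x v t df.
  move=> ?; apply: is_derive_eq.
  rewrite /h' /GRing.scale /=.
  by rewrite mulr0 add0r mulr1 mulr0 add0r !mulr1 mulrDr; congr (_ - _); lra.
have [|c] := MVT ltr01 (fun t _ => dh t).
  apply: derivable_within_continuous => t _.
  by have [] := dh t.
rewrite in_itv /= => /andP[c0 c1].
rewrite /h scale0r scale1r addr0 subr0 mulr1 => e.
have : dotv (gradient f (x + c *: v) - gradient f x) v <= c * (L * dotv v v).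
  apply: le_trans (dotv_le_enorm _ _) _.
  have := sm (x + c *: v) x; rewrite addrAC subrr add0r => le1.
  apply: le_trans (ler_wpM2r (enorm_ge0 _) le1) _.
  have -> : enorm (c *: v) = c * enorm v.
    by rewrite /enorm !dotvE mulrA -expr2 sqrtrM ?sqr_ge0 // sqrtr_sqr gtr0_norm.
  by rewrite -enorm_sqr expr2 le_eqVlt; apply/orP; left; apply/eqP; ring.
rewrite !dotvE; move: e; rewrite /h'; lra.
Qed.

Lemma smooth_min_le L f xs x e : (forall y, differentiable f y) ->
  smooth L f -> (forall y, f xs <= f y) ->
  2 * dotv (gradient f x) e <= f x - f xs + 2 * L * dotv e e.
Proof.
move=> df sm fmin; have := descent_lemma x (- 2 *: e) df sm.
have := fmin (x - 2 *: e); rewrite scaleNr !dotvE; lra.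
Qed.

(** At [x = xs] and e = u / (L + 1), [smooth_min_le] becomes 2 (L + 1) |u|^2 <= 2 L |u|^2 after
    clearing denominators, so u = 0. Dividing by L + 1 and not by L covers L = 0. *)
Lemma gradient_min L f xs : (forall y, differentiable f y) ->
  smooth L f -> (forall y, f xs <= f y) -> gradient f xs = 0.
Proof.
move=> df sm fmin; set u := gradient f xs.
have L0 : 0 <= L by case: sm.
have := smooth_min_le xs ((L + 1)^-1 *: u) df sm fmin.
rewrite subrr add0r !dotvE -/u => h.
have L1 : 0 < L + 1 by lra.
have : dotv u u <= 0.
  have {h} : (L + 1) * (L + 1) * (2 * ((L + 1)^-1 * dotv u u)) <=
    (L + 1) * (L + 1) * (2 * L * ((L + 1)^-1 * ((L + 1)^-1 * dotv u u))).
    by rewrite ler_pM2l // mulr_gt0.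
  set l := (L + 1)^-1; have ll : (L + 1) * l = 1 by rewrite mulfV ?gt_eqF.
  have -> : (L + 1) * (L + 1) * (2 * (l * dotv u u)) =
    2 * (L + 1) * ((L + 1) * l) * dotv u u by ring.
  have -> : (L + 1) * (L + 1) * (2 * L * (l * (l * dotv u u))) =
    2 * L * ((L + 1) * l) * ((L + 1) * l) * dotv u u by ring.
  by rewrite ll; lra.
move=> u0; have {u0} : dotv u u = 0 by apply/le_anti; rewrite u0 dotvv_ge0.
move=> /eqP; rewrite psumr_eq0; last by move=> j _; rewrite -expr2 sqr_ge0.
move=> /allP u0; apply/rowP => j; rewrite mxE.
by have := u0 j (mem_index_enum _); rewrite mulf_eq0 orbb mxE => /eqP ->; rewrite mxE.
Qed.

Lemma gap_le L f xs x : (forall y, differentiable f y) ->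
  smooth L f -> (forall y, f xs <= f y) ->
  f x - f xs <= L / 2 * dotv (x - xs) (x - xs).
Proof.
move=> df sm fmin; have := descent_lemma xs (x - xs) df sm.
rewrite (gradient_min df sm fmin) addrC subrK.
by rewrite -(scale0r (0 : 'rV[R]_d)) dotvZl; lra.
Qed.

(* Along the ray [t |-> xs + t v] the gap [phi] satisfies
   [t phi' >= phi + mu t^2 |v|^2 / 2], i.e. [(phi / t)' >= mu |v|^2 / 2]. *)
Lemma quadratic_growth L mu f xs v : (forall y, differentiable f y) ->
  smooth L f -> (forall y, f xs <= f y) -> quasi_strongly_convex mu f xs ->
  mu / 2 * dotv v v <= f (xs + v) - f xs.
Proof.
move=> df sm fmin qsc.
pose phi (t : R) := f (xs + t *: v) - f xs.
pose phi' (t : R) := dotv (gradient f (xs + t *: v)) v.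
have growth t : t * phi' t >= phi t + t ^+ 2 * (mu / 2 * dotv v v).
  have := qsc (xs + t *: v); rewrite enorm_sqr opprD addrA subrr sub0r.
  rewrite (addrC xs) addrK (addrC _ xs) !dotvE /phi /phi'; lra.
(* Since phi / t is singular at 0, the mean value theorem is applied on [s, 1]. Discarding psi(s) >=
   0 leaves the bound with the factor 1 - s. *)
have key (s : R) : 0 < s < 1 -> (1 - s) * (mu / 2 * dotv v v) <= phi 1.
  move=> /andP[s0 s1].
  pose psi (t : R) := t^-1 * phi t.
  pose psi' (t : R) := t^-1 * phi' t - t ^- 2 * phi t.
  have dpsi (t : R) : 0 < t -> is_derive t (1 : R) psi (psi' t).
    move=> t0; have := is_derive_line xs v t df => ?.
    have tn0 : t != 0 by rewrite gt_eqF.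
    have := is_deriveV (f := id) tn0 (is_derive_id t (1 : R)) => ?.
    apply: is_derive_eq.
    rewrite /psi' /GRing.scale /=.
    by rewrite /phi /phi'; ring.
  have [||c] := @MVT R psi psi' s 1 s1.
  - by move=> t; rewrite in_itv /= => /andP[st _]; apply: dpsi; lra.
  - apply: derivable_within_continuous => t; rewrite in_itv /= => /andP[st _].
    by have [] := dpsi t (lt_le_trans s0 st).
  rewrite in_itv /= => /andP[cs c1] e.
  have c0 : 0 < c by lra.
  have : mu / 2 * dotv v v <= psi' c.
    rewrite /psi'.
    have -> : c^-1 * phi' c - c ^- 2 * phi c = c ^- 2 * (c * phi' c - phi c).
      by field; rewrite gt_eqF.
    rewrite ler_pdivlMl ?exprn_gt0 //.
    by have := growth c; lra.
  have : 0 <= psi s by rewrite mulr_ge0 ?invr_ge0 ?(ltW s0) // subr_ge0.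
  have -> : phi 1 = psi 1 by rewrite /psi invr1 mul1r.
  by move: e; nra.
have -> : f (xs + v) - f xs = phi 1 by rewrite /phi scale1r.
apply/ler_addgt0Pr => e e0.
have [q0|q0] := leP (mu / 2 * dotv v v) 0.
  by have := fmin (xs + v); rewrite /phi scale1r; lra.
set q := mu / 2 * dotv v v in key q0 *.
have qe0 : 0 < q + e by lra.
(* An explicit form of the limit s -> 0: from s (q + e) = e follows s q <= e, hence (1 - s) q >= q -
   e. *)
have s01 : 0 < e / (q + e) < 1.
  by rewrite divr_gt0 //= ltr_pdivrMr // mul1r; lra.
have := key _ s01; set s := e / _ => ks.
have : s * (q + e) = e by rewrite divfK ?gt_eqF.
have := proj1 (andP s01); rewrite -/s; nra.
Qed.

(** The gap at [xs + v] lies between mu |v|^2 / 2 and L |v|^2 / 2. The factor |v|^2 is kept because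
    mu <= L may fail in dimension 0. *)
Lemma strong_convexity_le_smoothness L mu f xs v :
  (forall y, differentiable f y) ->
  smooth L f -> (forall y, f xs <= f y) -> quasi_strongly_convex mu f xs ->
  mu * dotv v v <= L * dotv v v.
Proof.
move=> df sm fmin qsc; have := quadratic_growth v df sm fmin qsc.
have := gap_le (xs + v) df sm fmin; rewrite (addrC xs) addrK; lra.
Qed.

(* Here [x - e] is the virtual iterate. *)
Lemma virtual_descent L mu f xs x e : (forall y, differentiable f y) ->
  smooth L f -> (forall y, f xs <= f y) -> quasi_strongly_convex mu f xs ->
  0 <= mu ->
  f x - f xs + mu / 2 * dotv (x - e - xs) (x - e - xs) - 3 * L * dotv e e
    <= 2 * dotv (gradient f x) (x - e - xs).
Proof.
move=> df sm fmin qsc mu0.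
have := strong_convexity_le_smoothness e df sm fmin qsc.
have := smooth_min_le x e df sm fmin.
have := qsc x; rewrite enorm_sqr.
have -> : x - e - xs = (x - xs) - e by rewrite addrAC.
(* With z = x - xs this says |z - e|^2 <= 2 |z|^2 + 2 |e|^2, so mu |z|^2 >= mu |z - e|^2 / 2 - mu
   |e|^2. The constant 3 L is 2 L from [smooth_min_le] plus one L that bounds mu. *)
have := dotvv_ge0 (x - xs + e).
rewrite -(opprB x xs); move: (x - xs) => z zz.
have := ler_wpM2l mu0 zz; rewrite !dotvE (dotvC e z).
lra.
Qed.

Lemma jensen_weighted f (w : nat -> R) (x : nat -> 'rV[R]_d) (K : nat) :
  convex_function (setT : set (convex_lmodType 'rV[R]_d)) f ->
  (forall k, 0 < w k) ->
  f ((\sum_(k < K.+1) w k)^-1 *: \sum_(k < K.+1) w k *: x k) <=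
  (\sum_(k < K.+1) w k)^-1 * \sum_(k < K.+1) w k * f (x k).
Proof.
move=> cf w0; elim: K => [|K IH].
  by rewrite !big_ord1 scalerA mulrA mulVf ?gt_eqF // scale1r mul1r.
set W := \sum_(i < K.+1) w i in IH *.
set X := \sum_(i < K.+1) w i *: x i in IH *.
set Y := \sum_(i < K.+1) w i * f (x i) in IH *.
have -> : \sum_(i < K.+2) w i = W + w K.+1 by rewrite big_ord_recr.
have -> : \sum_(i < K.+2) w i *: x i = X + w K.+1 *: x K.+1 by rewrite big_ord_recr.
have -> : \sum_(i < K.+2) w i * f (x i) = Y + w K.+1 * f (x K.+1) by rewrite big_ord_recr.
have W0 : 0 < W.
  by rewrite /W big_ord_recl ltr_wpDr // sumr_ge0 // => k _; exact: ltW.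
have W10 : 0 < W + w K.+1 by rewrite addr_gt0.
have p01 : 0 <= W / (W + w K.+1) <= 1.
  by rewrite divr_ge0 ?ltW //= ltr_pdivrMr // mul1r ltrDl.
(* The new average is a two-point convex combination: the old average has weight [p] and the new
   point has weight 1 - p. *)
pose p := Itv01 (proj1 (andP p01)) (proj2 (andP p01)).
have := cf p (W^-1 *: X) (x K.+1).
rewrite !in_setT => /(_ isT isT).
have -> : conv p (W^-1 *: X : convex_lmodType 'rV[R]_d) (x K.+1) =
   (W + w K.+1)^-1 *: (X + w K.+1 *: x K.+1).
  rewrite /conv /= scalerDr !scalerA /unstable.onem; congr (_ *: _ + _ *: _).
    by field; rewrite !gt_eqF.
  by field; rewrite gt_eqF.
move=> /le_trans; apply; rewrite convRE /=.
have -> : (W + w K.+1)^-1 * (Y + w K.+1 * f (x K.+1)) =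
   W / (W + w K.+1) * (W^-1 * Y) + (1 - W / (W + w K.+1)) * f (x K.+1).
  by field; rewrite !gt_eqF.
by rewrite lerD2r ler_wpM2l // (andP p01).1.
Qed.
End smooth_functions.

(** * Measurability *)

Section borel_row_vectors.
Context {R : realType} {d : nat}.

(** Sup-norm boxes with rational centre and radius are indexed by a countable type. Every open set
    is thus a countable union of sets given by conditions on coordinates, which reduces Borel
    measurability to that of the coordinates. *)
Let box (qr : 'rV[rat]_d * rat) : set 'rV[R]_d :=
  [set x | forall j, `|x 0 j - ratr (qr.1 0 j)| < ratr qr.2].

Let open_bigcup_box (U : set 'rV[R]_d) : open U ->
  U = \bigcup_qr [set x | box qr x /\ box qr `<=` U].
Proof.
move=> oU; apply/seteqP; split => [x Ux|x [qr _ [bx]]]; last exact.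
have [e e0 eU] : exists2 e : R, 0 < e & ball x e `<=` U.
  by move: oU; rewrite openE => /(_ _ Ux) /nbhs_ballP[e e0 eU]; exists e.
(* The radius is below e / 2: both [x] and any point of the box are within [r] of the centre, so
   they are less than [e] apart. *)
have [r] := rat_in_itvoo (divr_gt0 e0 (ltr0Sn R 1)).
rewrite in_itv /= => /andP[r0 re].
have q_ex j : exists q : rat, `|x 0 j - ratr q| < ratr r.
  have [|q] := @rat_in_itvoo R (x 0 j - ratr r) (x 0 j + ratr r).
    by rewrite ltrBlDr -addrA ltrDl addr_gt0.
  by rewrite in_itv /= => /andP[q1 q2]; exists q; rewrite ltr_norml; lra.
have [q qP] := choice q_ex.
exists (\row_j q j, r) => //; split => [j|y by_]; first by rewrite mxE.
apply: eU; split => // i j; rewrite (ord1 i) /ball /=.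
have := by_ j; have := qP j; rewrite mxE => h1 h2.
rewrite (le_lt_trans (ler_distD (ratr (q j)) _ _)) // (distrC (ratr _)).
lra.
Qed.

Lemma continuous_measurable_rV (h : 'rV[R]_d -> R) : continuous h ->
  measurable_fun [set: borel_rV R d] (h : borel_rV R d -> R).
Proof.
move=> /continuousP ch.
apply: (measurability _ (RGenOpens.measurableE R)) => _ [_ [a [b ->]] <-].
rewrite setTI; apply: sub_sigma_algebra.
exact/ch/interval_open.
Qed.

Lemma measurable_rVP {dT : measure_display} {T : measurableType dT}
    (X : T -> 'rV[R]_d) :
  measurable_fun [set: T] (X : T -> borel_rV R d) <->
  forall j, measurable_fun [set: T] (fun w => X w 0 j).
Proof.
split => [mX j|mX].
  apply: (measurableT_comp (continuous_measurable_rV (@coord_continuous R 1 d 0 j)) mX).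
apply: (@measurability _ _ T (borel_rV R d) setT X open erefl) => _ [U oU <-].
rewrite setTI (open_bigcup_box oU) preimage_bigcup.
apply: countable_bigcupT_measurable; first exact: countableP.
move=> qr; have [bU|nbU] := pselect (box qr `<=` U); last first.
  rewrite (_ : _ @^-1` _ = set0) //.
  by apply/seteqP; split => // w [].
rewrite (_ : _ @^-1` _ = \bigcap_(j in [set: 'I_d])
    ((fun w => X w 0 j - ratr (qr.1 0 j)) @^-1` `](- ratr qr.2), ratr qr.2[)).
  apply: fin_bigcap_measurable; first exact: finite_finset.
  move=> j _; rewrite -[X in measurable X]setTI.
  apply: measurable_funB => //; exact: mX.
apply/seteqP; split => w /=.
  by move=> [h _] j _ /=; rewrite in_itv /= -ltr_norml; exact: h.
move=> h; split => // j; have := h j I.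
by rewrite /= in_itv /= -ltr_norml.
Qed.

Lemma measurable_dotv {dT : measure_display} {T : measurableType dT}
    (X Y : T -> 'rV[R]_d) :
  measurable_fun [set: T] (X : T -> borel_rV R d) ->
  measurable_fun [set: T] (Y : T -> borel_rV R d) ->
  measurable_fun [set: T] (fun w => dotv (X w) (Y w)).
Proof.
move=> /measurable_rVP mX /measurable_rVP mY.
by apply: measurable_sum => j; exact: measurable_funM.
Qed.

Lemma measurable_rVD {dT : measure_display} {T : measurableType dT}
    (X Y : T -> 'rV[R]_d) :
  measurable_fun [set: T] (X : T -> borel_rV R d) ->
  measurable_fun [set: T] (Y : T -> borel_rV R d) ->
  measurable_fun [set: T] ((fun w => X w + Y w) : T -> borel_rV R d).
Proof.
move=> /measurable_rVP mX /measurable_rVP mY; apply/measurable_rVP => j.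
by under eq_fun do rewrite mxE; exact: measurable_funD.
Qed.

Lemma measurable_rVZ {dT : measure_display} {T : measurableType dT}
    (a : R) (X : T -> 'rV[R]_d) :
  measurable_fun [set: T] (X : T -> borel_rV R d) ->
  measurable_fun [set: T] ((fun w => a *: X w) : T -> borel_rV R d).
Proof.
move=> /measurable_rVP mX; apply/measurable_rVP => j.
by under eq_fun do rewrite mxE; exact: measurable_funM.
Qed.

Lemma measurable_rVB {dT : measure_display} {T : measurableType dT}
    (X Y : T -> 'rV[R]_d) :
  measurable_fun [set: T] (X : T -> borel_rV R d) ->
  measurable_fun [set: T] (Y : T -> borel_rV R d) ->
  measurable_fun [set: T] ((fun w => X w - Y w) : T -> borel_rV R d).
Proof.
move=> mX mY; under eq_fun do rewrite -scaleN1r.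
by apply: measurable_rVD => //; exact: measurable_rVZ.
Qed.

Lemma measurable_rV_sum {dT : measure_display} {T : measurableType dT}
    (I : Type) (s : seq I) (X : I -> T -> 'rV[R]_d) :
  (forall i, measurable_fun [set: T] (X i : T -> borel_rV R d)) ->
  measurable_fun [set: T] ((fun w => \sum_(i <- s) X i w) : T -> borel_rV R d).
Proof.
move=> mX; apply/measurable_rVP => j.
under eq_fun do rewrite summxE.
by apply: measurable_sum => i; have /measurable_rVP := mX i; exact.
Qed.

End borel_row_vectors.

Section measurable_wrt.
Context {dT dU : measure_display} {T : measurableType dT}
  {U : measurableType dU}.
Implicit Types (G H : set (set T)) (X : T -> U).

(** Viewing [T] as a measurable space with sigma-algebra [G] makes the closure lemmas for measurable
    functions available for adaptedness. *)
Lemma measurable_wrtP G X : sigma_algebra setT G ->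
  measurable_wrt G X <->
  measurable_fun [set: g_sigma_algebraType G] (X : g_sigma_algebraType G -> U).
Proof.
move=> sG; split => [mX _ B mB|mX B mB].
  by rewrite setTI; apply: sub_sigma_algebra; exact: mX.
by rewrite -[_ @^-1` _]setTI -(sigma_algebra_id sG); exact: mX.
Qed.

Lemma measurable_wrtS G H X : G `<=` H -> measurable_wrt G X ->
  measurable_wrt H X.
Proof. by move=> GH mX B mB; apply: GH; exact: mX. Qed.

Lemma measurable_wrt_fun G X : G `<=` measurable -> measurable_wrt G X ->
  measurable_fun [set: T] X.
Proof. by move=> Gm mX _ B mB; rewrite setTI; apply: Gm; exact: mX. Qed.

End measurable_wrt.

(** * Adaptedness of the errors and of the iterates *)

Section ec_measurability.
Context {R : realType} {n d : nat} {dT dS : measure_display}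
  {T : measurableType dT} {S : measurableType dS}.
Variables (comp : S -> 'rV[R]_d -> 'rV[R]_d) (gamma : R) (x0 : 'rV[R]_d).
Variables (g : nat -> 'I_n -> T -> 'rV[R]_d) (xi : nat -> 'I_n -> T -> S).
Variables (P : probability T R) (Q : probability S R) (Fk : nat -> set (set T)).
Hypothesis mcomp : measurable_fun [set: S * borel_rV R d]
        (fun p => comp p.1 p.2 : borel_rV R d).
Hypothesis hrand : ec_sgd_randomness comp gamma g xi P Q Fk.

Lemma ec_sigma_algebra k : sigma_algebra setT (Fk k).
Proof. by have [] := ec_filtration hrand k. Qed.

Lemma ec_sub_measurable k : Fk k `<=` measurable.
Proof. by have [] := ec_filtration hrand k. Qed.

(** The source is arbitrary so that it can be [T] equipped with [Fk k.+1]. *)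
Lemma ec_message_measurable {dT'} {T' : measurableType dT'}
    (s : T' -> S) (e h : T' -> 'rV[R]_d) :
  measurable_fun [set: T'] s ->
  measurable_fun [set: T'] (e : T' -> borel_rV R d) ->
  measurable_fun [set: T'] (h : T' -> borel_rV R d) ->
  measurable_fun [set: T']
    ((fun w => ec_message comp gamma (s w) (e w) (h w)) : T' -> borel_rV R d).
Proof.
move=> ms me mh; apply: measurable_rVZ.
pose u w : borel_rV R d := gamma^-1 *: (e w + gamma *: h w).
apply: (@measurableT_comp _ _ _ _ _ _ _ _ (fun w => (s w, u w)) mcomp).
apply: measurable_fun_pair => //.
by apply: measurable_rVZ; apply: measurable_rVD => //; exact: measurable_rVZ.
Qed.

Lemma ec_error_adapted k i :
  measurable_wrt (Fk k) (ec_error comp gamma g xi k i : T -> borel_rV R d).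
Proof.
elim: k => [|k IH].
  by apply/measurable_wrtP; [exact: ec_sigma_algebra|exact: measurable_cst].
have [_ _ FS] := ec_filtration hrand k.
apply/measurable_wrtP; first exact: ec_sigma_algebra.
have me := (measurable_wrtP _ (ec_sigma_algebra k.+1)).1 (measurable_wrtS FS IH).
have mg := (measurable_wrtP _ (ec_sigma_algebra k.+1)).1 (ec_grad_adapted hrand k i).
have mx := (measurable_wrtP _ (ec_sigma_algebra k.+1)).1 (ec_seed_adapted hrand k i).
apply: measurable_rVB; last exact: ec_message_measurable.
by apply: measurable_rVD => //; exact: measurable_rVZ.
Qed.

Lemma ec_iter_adapted k :
  measurable_wrt (Fk k) (ec_iter comp gamma x0 g xi k : T -> borel_rV R d).
Proof.
elim: k => [|k IH].
  by apply/measurable_wrtP; [exact: ec_sigma_algebra|exact: measurable_cst].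
have [_ _ FS] := ec_filtration hrand k.
apply/measurable_wrtP; first exact: ec_sigma_algebra.
have mi := (measurable_wrtP _ (ec_sigma_algebra k.+1)).1 (measurable_wrtS FS IH).
apply: measurable_rVB => //; apply: measurable_rVZ; apply: measurable_rV_sum => i.
have me := (measurable_wrtP _ (ec_sigma_algebra k.+1)).1
  (measurable_wrtS FS (@ec_error_adapted k i)).
have mg := (measurable_wrtP _ (ec_sigma_algebra k.+1)).1 (ec_grad_adapted hrand k i).
have mx := (measurable_wrtP _ (ec_sigma_algebra k.+1)).1 (ec_seed_adapted hrand k i).
exact: ec_message_measurable.
Qed.

End ec_measurability.

(** * Expectations and conditioning *)

Section expectations.
Context {dT : measure_display} {T : measurableType dT} {R : realType}.
Variable P : probability T R.
Implicit Types (X Y Z : T -> R) (G : set (set T)).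

Local Notation L1 X := (P.-integrable [set: T] (EFin \o X)).
Local Notation E X := (Rintegral P [set: T] X).

Lemma L1_le X Y : measurable_fun [set: T] X -> (forall w, `|X w| <= Y w) ->
  L1 Y -> L1 X.
Proof.
move=> mX XY; apply: le_integrable => //; first exact/measurable_EFinP.
move=> w _; rewrite /= lee_fin; apply: le_trans (XY w) _; exact: ler_norm.
Qed.

Lemma L1_measurable X : L1 X -> measurable_fun [set: T] X.
Proof. by move=> /measurable_int /measurable_EFinP. Qed.

Lemma L1D X Y : L1 X -> L1 Y -> L1 (fun w => X w + Y w).
Proof. by move=> iX iY; apply: eq_integrable (integrableD _ iX iY). Qed.

Lemma L1Z a X : L1 X -> L1 (fun w => a * X w).
Proof. by move=> iX; apply: eq_integrable (integrableZl _ a iX). Qed.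

Lemma L1B X Y : L1 X -> L1 Y -> L1 (fun w => X w - Y w).
Proof. by move=> iX iY; apply: eq_integrable (integrableB _ iX iY). Qed.

Lemma L1_cst a : L1 (fun=> a).
Proof.
by apply: finite_measure_integrable_cst.
Qed.

Lemma L1_abs X : L1 X -> L1 (fun w => `|X w|).
Proof. by move=> /integrable_abse iX; apply: eq_integrable iX. Qed.

Lemma L1_sum (I : Type) (s : seq I) (X : I -> T -> R) : (forall i, L1 (X i)) ->
  L1 (fun w => \sum_(i <- s) X i w).
Proof.
move=> iX; have := @integrable_sum _ _ _ P setT measurableT I s xpredT
  (fun i => EFin \o X i) (fun i _ => iX i).
by apply: eq_integrable => // w _; rewrite /= sumEFin.
Qed.

Lemma E_cst a : E (fun=> a) = a.
Proof. by rewrite Rintegral_cst // /= probability_setT /= mulr1. Qed.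

Lemma E_sum (I : Type) (s : seq I) (X : I -> T -> R) : (forall i, L1 (X i)) ->
  E (fun w => \sum_(i <- s) X i w) = \sum_(i <- s) E (X i).
Proof.
move=> iX; elim: s => [|i s IH].
  by rewrite big_nil -[RHS]E_cst; apply: eq_Rintegral => w _; rewrite big_nil.
rewrite big_cons -IH -RintegralD //; last exact: L1_sum.
by apply: eq_Rintegral => w _; rewrite big_cons.
Qed.

Lemma E_le X Y : L1 X -> L1 Y -> (forall w, X w <= Y w) -> E X <= E Y.
Proof. by move=> iX iY XY; apply: le_Rintegral. Qed.

Lemma E_ge0 X : (forall w, 0 <= X w) -> 0 <= E X.
Proof. by move=> X0; apply: Rintegral_ge0. Qed.

Lemma E_EFin X : L1 X -> (\int[P]_w (X w)%:E)%E = (E X)%:E.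
Proof. by move=> iX; rewrite fineK //; exact: integrable_fin_num. Qed.

Lemma ge0_L1 X c : measurable_fun [set: T] X -> (forall w, 0 <= X w) ->
  (\int[P]_w (X w)%:E <= c%:E)%E -> L1 X /\ E X <= c.
Proof.
move=> mX X0 Xc; have iX : L1 X.
  apply/integrableP; split; first exact/measurable_EFinP.
  rewrite (eq_integral (fun w => (X w)%:E)) => [|w _].
    by rewrite (le_lt_trans Xc) // ltry.
  by rewrite /= ger0_norm.
by split=> //; move: Xc; rewrite E_EFin // lee_fin.
Qed.

Lemma L2_mul X Y : measurable_fun [set: T] X -> measurable_fun [set: T] Y ->
  L1 (fun w => X w ^+ 2) -> L1 (fun w => Y w ^+ 2) -> L1 (fun w => X w * Y w).
Proof.
move=> mX mY X2 Y2; apply: L1_le (L1D X2 Y2); first exact: measurable_funM.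
move=> w; rewrite normrM -(real_normK (num_real (X w))) -(real_normK (num_real (Y w))).
have := sqr_ge0 (`|X w| - `|Y w|); have := sqr_ge0 (`|X w| + `|Y w|).
nra.
Qed.

Lemma L2_L1 X : measurable_fun [set: T] X -> L1 (fun w => X w ^+ 2) -> L1 X.
Proof.
move=> mX X2; have := @L2_mul X (fun=> 1) mX (measurable_cst _) X2 (L1_cst _).
by apply: eq_integrable => // w _; rewrite /= mulr1.
Qed.

Import HBNNSimple.

(* [Z] is the increasing limit of [G]-simple functions, for which the claim is
   the hypothesis on [X]. *)
Lemma Rintegral_mul_ge0_eq0 G X Z : sigma_algebra setT G -> G `<=` measurable ->
  L1 X -> (forall A, G A -> \int[P]_(w in A) X w = 0) ->
  measurable_wrt G Z -> (forall w, 0 <= Z w) -> L1 (fun w => Z w * X w) ->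
  E (fun w => Z w * X w) = 0.
Proof.
move=> sG Gm iX X0 mZ Z0 iZX.
have GE A : <<s G >> A -> G A by rewrite (sigma_algebra_id sG).
have mZ' := (measurable_wrtP _ sG).1 mZ.
have mZG : measurable_fun [set: g_sigma_algebraType G]
    (EFin \o Z : g_sigma_algebraType G -> \bar R).
  exact/measurable_EFinP.
(* Approximating on the space that carries [G] puts the level sets of each [h n] in [G], where [X]
   integrates to 0. *)
pose h := nnsfun_approx measurableT mZG.
have hG n B : measurable B -> G ((h n : T -> R) @^-1` B).
  move=> mB; apply: GE; rewrite -[X in <<s G >> X]setTI.
  have mhn : measurable_fun [set: g_sigma_algebraType G] (h n) by [].
  exact: mhn.
have mh n : measurable_fun [set: T] (h n : T -> R).
  by move=> _ B mB; rewrite setTI; apply: Gm; exact: hG.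
have h0 n w : 0 <= h n w by [].
have hZ n w : h n w <= Z w.
  rewrite -lee_fin /h nnsfun_approxE.
  by apply: (@le_approx _ _ _ _ (EFin \o Z) n w) => // x _; rewrite lee_fin.
have cvgh w : (h n w * X w)%:E @[n --> \oo] --> (Z w * X w)%:E.
  apply: cvg_EFin; first by apply: nearW.
  apply: cvgMl.
  have := @cvg_nnsfun_approx _ _ _ _ measurableT _ mZG (fun w _ => _) w I.
  move=> /(_ _)/fine_cvg; apply => x; rewrite lee_fin; exact: Z0.
have Eh n : (\int[P]_w (h n w * X w)%:E = 0)%E.
  pose s : seq R := finmap.enum_fset (fset_set (range (h n))).
  have mA r : G ((h n : T -> R) @^-1` [set r]) by exact: hG.
  have iA r : L1 (fun w => \1_((h n : T -> R) @^-1` [set r]) w * X w).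
    apply: L1_le (L1_abs iX).
      apply: measurable_funM; last exact: L1_measurable.
      by apply: measurable_indic; exact: Gm.
    by move=> w; rewrite normrM ler_piMl // indicE; case: (_ \in _); rewrite ?normr1 ?normr0.
  rewrite (eq_integral (fun w =>
      (\sum_(y <- s) y * (\1_((h n : T -> R) @^-1` [set y]) w * X w))%:E)); last first.
    move=> w _; rewrite fimfunE fsbig_finite //= mulr_suml.
    by congr (_%:E); apply: eq_bigr => y _; rewrite mulrA.
  rewrite E_EFin; last by apply: L1_sum => i; exact: L1Z.
  rewrite E_sum //; last by move=> i; exact: L1Z.
  congr (_%:E); apply: big1 => y _.
  rewrite RintegralZl //.
  rewrite [X in _ * X](_ : _ = 0) ?mulr0 //.
  rewrite -[RHS](X0 _ (mA y)) [RHS]Rintegral_mkcond.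
  apply: eq_Rintegral => w _; rewrite patchE indicE.
  by case: ifP => _; rewrite ?mul1r ?mul0r.
(* Since 0 <= h n <= Z, the function |Z X| dominates. *)
have [|||||_ _] := @dominated_convergence _ _ _ P setT measurableT
  (fun n w => (h n w * X w)%:E) (fun w => (Z w * X w)%:E)
  (fun w => (`|Z w * X w|)%:E).
- move=> n; apply/measurable_EFinP; apply: measurable_funM => //; exact: L1_measurable.
- exact: measurable_int iZX.
- by apply: aeW => w _; exact: cvgh.
- by apply: eq_integrable (integrable_abse iZX).
- apply: aeW => w n _; rewrite lee_fin !normrM ler_wpM2r //.
  by rewrite !ger0_norm.
under eq_fun do rewrite /= Eh.
move=> /cvg_lim; rewrite lim_cst // => /(_ _) e.
by rewrite /Rintegral -e.
Qed.

(** A [G]-measurable factor passes through conditioning. The difference X - Y integrates to 0 over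
    every set of [G], and the positive and negative parts of [Z] are treated separately; both are at
    most |Z|, which preserves integrability. *)
Lemma condexp_mul G X Y Z : sigma_algebra setT G -> G `<=` measurable ->
  is_condexp P G (EFin \o X) (EFin \o Y) -> L1 X -> L1 Y ->
  measurable_wrt G Z -> L1 (fun w => Z w * X w) -> L1 (fun w => Z w * Y w) ->
  E (fun w => Z w * X w) = E (fun w => Z w * Y w).
Proof.
move=> sG Gm [_ _ _ XY] iX iY mZ iZX iZY.
have mZT := measurable_wrt_fun Gm mZ.
pose D w := X w - Y w.
have iD : L1 D by exact: L1B.
have D0 A : G A -> \int[P]_(w in A) D w = 0.
  move=> GA; have mA : measurable A by exact: Gm.
  rewrite RintegralB //; try exact: integrableS measurableT mA _ _.
  by apply/eqP; rewrite subr_eq0 /Rintegral; apply/eqP; congr fine; exact: XY.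
have iZD : L1 (fun w => Z w * D w).
  by apply: eq_integrable (L1B iZX iZY) => // w _; rewrite /= mulrBr.
have part (Z' : T -> R) : measurable_wrt G Z' -> (forall w, 0 <= Z' w <= `|Z w|) ->
    L1 (fun w => Z' w * D w) /\ E (fun w => Z' w * D w) = 0.
  move=> mZ' Z'0.
  have iZ'D : L1 (fun w => Z' w * D w).
    apply: L1_le (fun w => `|Z w * D w|) _ _ _.
    - by apply: measurable_funM; [exact: measurable_wrt_fun mZ'|exact: L1_measurable].
    - by move=> w; have /andP[z0 zZ] := Z'0 w; rewrite !normrM ler_wpM2r // ger0_norm.
    - by apply: eq_integrable (integrable_abse iZD).
  split=> //; apply: (Rintegral_mul_ge0_eq0 sG) => // w.
  by have /andP[] := Z'0 w.
have [|| ip Ep] := part (fun w => Num.max (Z w) 0).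
- apply/measurable_wrtP => //; apply: measurable_maxr => //; exact/measurable_wrtP.
- by move=> w; rewrite le_max lexx orbT ge_max ler_norm /=.
have [|| im Em] := part (fun w => Num.max (- Z w) 0).
- apply/measurable_wrtP => //; apply: measurable_maxr => //.
  by apply: measurableT_comp => //; exact/measurable_wrtP.
- by move=> w; rewrite le_max lexx orbT ge_max -normrN ler_norm /=.
have Ed : E (fun w => Num.max (Z w) 0 * D w - Num.max (- Z w) 0 * D w) = 0.
  by rewrite RintegralB // Ep Em subr0.
apply/eqP; rewrite -subr_eq0 -RintegralB //; apply/eqP; rewrite -[RHS]Ed.
apply: eq_Rintegral => w _; rewrite -mulrBr -/(D w) -mulrBl; congr (_ * _).
by rewrite /Order.max; do 2!case: ifPn; rewrite -?leNgt; lra.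
Qed.

Lemma condexp_le_E G X Z : sigma_algebra setT G -> G `<=` measurable ->
  condexp_le P G X Z -> (forall w, 0 <= X w) -> (forall w, 0 <= Z w) -> L1 Z ->
  L1 X /\ E X <= E Z.
Proof.
move=> sG Gm [Y [mX _ mY XY] YZ] X0 Z0 iZ.
have GT : G setT.
  by case: sG => G0 GC _; have := GC _ G0; rewrite setD0.
apply: ge0_L1 => //; first exact/measurable_EFinP.
rewrite [leLHS](XY _ GT) -E_EFin //.
have mYT := measurable_wrt_fun Gm mY.
(* The version [Y] is extended-valued and its sign is not known, so it is compared with [Z] through
   its positive part; [Z >= 0] keeps the bound valid. *)
apply: (@le_trans _ _ (\int[P]_w (maxe (Y w) 0))%E).
  rewrite integralE -[leRHS]sube0; apply: leeB; last exact: integral_ge0.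
  rewrite le_eqVlt; apply/orP; left; apply/eqP.
  by apply: eq_integral => w _; rewrite funeposE.
apply: ae_ge0_le_integral => //.
- by move=> w _; rewrite le_max lexx orbT.
- exact: measurable_maxe.
- by move=> w _; rewrite lee_fin.
- exact: measurable_int iZ.
- by apply: filterS YZ => w Yw _; rewrite ge_max Yw lee_fin Z0.
Qed.
End expectations.

(* The joint law of independent [X] and [Y] is the product of their laws. *)
Lemma indep_integral_le {dT dU dV : measure_display} {T : measurableType dT}
    {U : measurableType dU} {V : measurableType dV} {R : realType}
    (P : probability T R) (Q : probability V R) (X : T -> U) (Y : T -> V)
    (h : U * V -> R) (c : R) :
  measurable_fun [set: T] X -> measurable_fun [set: T] Y -> indep_rv P X Y ->
  (forall B, measurable B -> P (Y @^-1` B) = Q B) ->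
  measurable_fun [set: U * V] h -> (forall p, 0 <= h p) ->
  (forall x, \int[Q]_y (h (x, y))%:E <= c%:E)%E ->
  (\int[P]_w (h (X w, Y w))%:E <= c%:E)%E.
Proof.
move=> mX mY XY YQ mh h0 hc.
have Xm : X \in mfun by rewrite inE.
pose m1 := distribution P (mfun_Sub Xm).
have mXY : measurable_fun [set: T] (fun w => (X w, Y w)) by exact: measurable_fun_pair.
have XYm : (fun w => (X w, Y w)) \in (mfun : {pred T -> U * V}) by rewrite inE.
pose m := distribution P (mfun_Sub XYm).
have mhE : measurable_fun [set: U * V] (EFin \o h) by exact/measurable_EFinP.
have -> : (\int[P]_w (h (X w, Y w))%:E = \int[m]_p (h p)%:E)%E.
  by rewrite ge0_integral_distribution // => p; rewrite lee_fin.
(* Independence gives equality on rectangles, which determines the product measure. Tonelli and the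
   total mass 1 of [m1] then finish. *)
have -> : (\int[m]_p (h p)%:E = \int[m1 \x Q]_p (h p)%:E)%E.
  apply: eq_measure_integral => A mA _; apply/esym.
  apply: product_measure_unique => // B C mB mC.
  by rewrite /m /m1 /distribution /pushforward /= -YQ // -XY.
rewrite (fubini_tonelli1 (EFin \o h)) //.
rewrite -[leRHS]mule1 -(probability_setT m1) -integral_cst //.
apply: ge0_le_integral => //.
- by move=> x _; apply: integral_ge0 => y _; rewrite lee_fin.
- by apply: measurable_fun_fubini_tonelli_F => // p; rewrite lee_fin.
- by move=> x _; exact: hc.
Qed.

(** * The EC-SGD recursion *)

Section averages.
Context {R : realType} {n d : nat}.
Hypothesis hn : (0 < n)%N.

Lemma dotv_suml (I : Type) (s : seq I) (v : I -> 'rV[R]_d) (u : 'rV[R]_d) :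
  dotv (\sum_(i <- s) v i) u = \sum_(i <- s) dotv (v i) u.
Proof.
elim: s => [|i s IH]; last by rewrite !big_cons dotvDl IH.
by rewrite !big_nil -(scale0r (0 : 'rV[R]_d)) dotvZl mul0r.
Qed.

Lemma averageD (u v : 'I_n -> 'rV[R]_d) :
  average (fun i => u i + v i) = average u + average v.
Proof. by rewrite /average big_split scalerDr. Qed.

Lemma averageN (u : 'I_n -> 'rV[R]_d) :
  average (fun i => - u i) = - average u.
Proof. by rewrite /average sumrN scalerN. Qed.

Lemma averageZ a (u : 'I_n -> 'rV[R]_d) :
  average (fun i => a *: u i) = a *: average u.
Proof. by rewrite /average -scaler_sumr !scalerA mulrC. Qed.

(** The sum of the |v_i - a|^2 is nonnegative and equals the sum of the |v_i|^2 minus n |a|^2. *)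
Lemma dotv_average_le (v : 'I_n -> 'rV[R]_d) :
  dotv (average v) (average v) <= n%:R^-1 * \sum_i dotv (v i) (v i).
Proof.
set a := average v.
have n0 : 0 < n%:R :> R by rewrite ltr0n.
have ea : \sum_i v i = n%:R *: a by rewrite scalerA mulfV ?gt_eqF // scale1r.
have : 0 <= \sum_i dotv (v i - a) (v i - a).
  by apply: sumr_ge0 => i _; exact: dotvv_ge0.
rewrite (eq_bigr (fun i => dotv (v i) (v i) - 2 * dotv (v i) a + dotv a a)); last first.
  by move=> i _; rewrite dotvBB.
rewrite big_split /= sumrB -mulr_sumr -dotv_suml ea dotvZl sumr_const card_ord.
rewrite -[X in _ + X]mulr_natl => h.
by rewrite ler_pdivlMl //; lra.
Qed.

Lemma differentiable_avg_fun (f_ : 'I_n -> 'rV[R]_d -> R) :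
  (forall i x, differentiable (f_ i) x) -> forall x, differentiable (avg_fun f_) x.
Proof.
move=> df x.
have -> : avg_fun f_ = n%:R^-1 \*: (\sum_i f_ i).
  by apply/funext => y; rewrite /avg_fun /= fct_sumE.
by apply: differentiableZ; apply: differentiable_sum.
Qed.

End averages.

(** Multiplying step K of the recursion by (1 - eta)^-(K+1) turns its contraction factor into the
    preceding power, so the [t] terms cancel. Here [K] counts steps; the averages up to index K use
    it at [K.+1]. *)
Lemma weighted_telescope {R : realType} (eta a c : R) (t phi : nat -> R) (K : nat) :
  eta < 1 ->
  (forall k, t k.+1 <= (1 - eta) * t k - a * phi k + c) ->
  a * \sum_(k < K) weight eta k * phi k + (1 - eta) ^- K * t K
    <= t 0%N + c * \sum_(k < K) weight eta k.
Proof.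
move=> eta1 rec; have q0 : 0 < 1 - eta by rewrite subr_gt0.
elim: K => [|K IH]; first by rewrite !big_ord0 !mulr0 add0r expr0 invr1 mul1r addr0.
rewrite !big_ord_recr /= {2 4}/weight.
have q1 : 0 < (1 - eta) ^- K.+1 by rewrite invr_gt0 exprn_gt0.
have := ler_wpM2l (ltW q1) (rec K).
move: IH; have -> : (1 - eta) ^- K = (1 - eta) ^- K.+1 * (1 - eta).
  by rewrite exprSr invfM -mulrA mulVf ?gt_eqF // mulr1.
lra.
Qed.

(** The variables stand for expectations: [Y] for |z^k - x*|^2, [Gr] and [Ge] for the cross term and
    |g^k|^2, [S0] and [S1] for F sigma^2 before and after the step, [Ph] for the gap, [Eb] for
    |e^k|^2. The gap gets -gamma + 2 gamma^2 (A + C F) <= -gamma / 2, and [S0] gets gamma^2 (1 - rho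
    / 4). *)
Lemma lyapunov_arith {R : realFieldType}
    (gamma mu L eta rho A CF D1 FD2 Delta2 Y Gr Ge S0 S1 Ph Eb : R) :
  0 <= gamma -> 0 <= L ->
  eta <= gamma * mu / 2 -> eta <= rho / 4 -> gamma * (A + CF) <= 1 / 4 ->
  Ph + mu / 2 * Y - 3 * L * Eb <= 2 * Gr ->
  Ge <= 2 * A * Ph + 3 / 4 * rho * S0 + D1 ->
  S1 <= (1 - rho) * S0 + 2 * CF * Ph + FD2 ->
  Eb <= gamma ^+ 2 * Delta2 -> 0 <= Y -> 0 <= S0 -> 0 <= Ph ->
  Y + (- 2 * gamma * Gr + gamma ^+ 2 * Ge) + gamma ^+ 2 * S1 <=
  (1 - eta) * (Y + gamma ^+ 2 * S0) - gamma / 2 * Ph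
    + gamma ^+ 2 * (D1 + FD2 + 3 * L * gamma * Delta2).
Proof.
move=> g0 L0 eta1 eta2 gam Edesc Eg Es1 Ee y0 s0 p0.
have g2 : 0 <= gamma ^+ 2 by exact: sqr_ge0.
have gL : 0 <= gamma * (3 * L) by rewrite mulr_ge0 ?mulr_ge0.
have h1 := ler_wpM2l g0 Edesc.
have h2 := ler_wpM2l g2 Eg.
have h3 := ler_wpM2l g2 Es1.
have h4 := ler_wpM2l gL Ee.
have h5 := ler_wpM2r y0 eta1.
have h6 := ler_wpM2r (mulr_ge0 g2 s0) eta2.
have h7 := ler_wpM2r (mulr_ge0 g0 p0) gam.
rewrite -subr_ge0 in h1.
rewrite -subr_ge0 in h2.
rewrite -subr_ge0 in h3.
rewrite -subr_ge0 in h4.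
rewrite -subr_ge0 in h5.
rewrite -subr_ge0 in h6.
rewrite -subr_ge0 in h7.
(* This sum of slacks equals exactly the right-hand side minus the left-hand side; the stepsize
   slack is taken twice. *)
have h := addr_ge0 (addr_ge0 (addr_ge0 h1 h2) (addr_ge0 h3 h4))
  (addr_ge0 (addr_ge0 h5 h6) (mulr_ge0 (ler0n R 2) h7)).
rewrite -subr_ge0; apply: le_trans h _; rewrite le_eqVlt.
by apply/orP; left; apply/eqP; field.
Qed.

(** * Moment bounds and the Lyapunov recursion *)

Section ec_sgd.
Context {R : realType} {n d : nat} (hn : (0 < n)%N).
Context {dT dS : measure_display} {T : measurableType dT} {S : measurableType dS}.
Variables (P : probability T R) (Q : probability S R).
Variables (f : 'rV[R]_d -> R) (xs : 'rV[R]_d) (mu L : R).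
Hypotheses (df : forall x, differentiable f x) (fmin : forall x, f xs <= f x).
Hypotheses (hmu : 0 <= mu) (hqsc : quasi_strongly_convex mu f xs)
  (hsmooth : smooth L f).
Variables (comp : S -> 'rV[R]_d -> 'rV[R]_d) (Delta : R).
Hypothesis hcomp : absolute_compressor Q comp Delta.
Variables (gamma : R) (x0 : 'rV[R]_d).
Variables (g : nat -> 'I_n -> T -> 'rV[R]_d) (xi : nat -> 'I_n -> T -> S).
Variable Fk : nat -> set (set T).
Hypothesis hrand : ec_sgd_randomness comp gamma g xi P Q Fk.
Variables (sigma2 : nat -> T -> R) (A B C D1 D2 rho : R).
Hypothesis hkpa : key_parametric_assumption P Fk f xs
            (ec_iter comp gamma x0 g xi) (mean_grad g) sigma2
            A B C D1 D2 rho.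
Hypothesis hgamma0 : 0 < gamma.

Local Notation L1 X := (P.-integrable [set: T] (EFin \o X)).
Local Notation E X := (Rintegral P [set: T] X).
Local Notation x := (ec_iter comp gamma x0 g xi).
Local Notation e := (ec_error comp gamma g xi).
Local Notation sqn v := (dotv v v).

(** The mean error; [y] below is the virtual iterate centred at [xs]. *)
Let ebar k w : 'rV[R]_d := average (fun i => e k i w).
Let y k w : 'rV[R]_d := x k w - ebar k w - xs.
Let gap k w : R := f (x k w) - f xs.
Let F : R := 4 * B / (3 * rho).

Let sG k : sigma_algebra setT (Fk k). Proof. exact: ec_sigma_algebra hrand k. Qed.
Let Gm k : Fk k `<=` measurable. Proof. exact: ec_sub_measurable hrand k. Qed.
Let mcomp : measurable_fun [set: S * borel_rV R d]
        (fun p => comp p.1 p.2 : borel_rV R d).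
Proof. by case: hcomp. Qed.

Let e_adapted k i : measurable_wrt (Fk k) (e k i : T -> borel_rV R d).
Proof. exact: (ec_error_adapted mcomp hrand). Qed.

Let x_adapted k : measurable_wrt (Fk k) (x k : T -> borel_rV R d).
Proof. exact: (ec_iter_adapted x0 mcomp hrand). Qed.

Let g_measurable k i : measurable_fun [set: T] (g k i : T -> borel_rV R d).
Proof. exact: measurable_wrt_fun (Gm (k := k.+1)) (ec_grad_adapted hrand k i). Qed.

Let xi_measurable k i : measurable_fun [set: T] (xi k i).
Proof. exact: measurable_wrt_fun (Gm (k := k.+1)) (ec_seed_adapted hrand k i). Qed.

Let e_measurable k i : measurable_fun [set: T] (e k i : T -> borel_rV R d).
Proof. exact: measurable_wrt_fun (Gm (k := k)) (e_adapted k i). Qed.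

Let x_measurable k : measurable_fun [set: T] (x k : T -> borel_rV R d).
Proof. exact: measurable_wrt_fun (Gm (k := k)) (x_adapted k). Qed.

Let ebar_adapted k : measurable_wrt (Fk k) (ebar k : T -> borel_rV R d).
Proof.
apply/(measurable_wrtP _ (sG k)); apply: measurable_rVZ.
apply: (@measurable_rV_sum R d _ (g_sigma_algebraType (Fk k)) _ _ (fun i => e k i)) => i.
exact: ((measurable_wrtP _ (sG k)).1 (e_adapted k i)).
Qed.

Let ebar_measurable k : measurable_fun [set: T] (ebar k : T -> borel_rV R d).
Proof. exact: measurable_wrt_fun (Gm (k := k)) (ebar_adapted k). Qed.

Let y_adapted k : measurable_wrt (Fk k) (y k : T -> borel_rV R d).
Proof.
apply/(measurable_wrtP _ (sG k)); apply: measurable_rVB; last exact: measurable_cst.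
by apply: measurable_rVB; [exact: ((measurable_wrtP _ (sG k)).1 (x_adapted k))|
  exact: ((measurable_wrtP _ (sG k)).1 (ebar_adapted k))].
Qed.

Let y_measurable k : measurable_fun [set: T] (y k : T -> borel_rV R d).
Proof. exact: measurable_wrt_fun (Gm (k := k)) (y_adapted k). Qed.

Let mean_grad_measurable k : measurable_fun [set: T] (mean_grad g k : T -> borel_rV R d).
Proof. by apply: measurable_rVZ; apply: measurable_rV_sum => i. Qed.

Let gap_measurable k : measurable_fun [set: T] (gap k).
Proof.
apply: measurable_funB => //.
apply: (measurableT_comp (continuous_measurable_rV _) (x_measurable k)).
by move=> v; apply: differentiable_continuous.
Qed.

Let gap_ge0 k w : 0 <= gap k w. Proof. by rewrite subr_ge0. Qed.

(** The mean message is subtracted from both the iterate and the mean error, so it cancels in their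
    difference. *)
Lemma y_succ k w : y k.+1 w = y k w - gamma *: mean_grad g k w.
Proof.
rewrite /y /ebar /= averageD averageN averageD averageZ -/(mean_grad g k w).
move: (average _) (average _) (mean_grad _ _ _) (x k w) => u v m z.
by apply/rowP => j; rewrite !mxE; ring.
Qed.

(** The error after a step is gamma (u - C(u)), where [u] is the compressed vector. The seed is
    independent of [u], so the compressor bound can be integrated over the law of [u]. The initial
    error is 0. *)
Lemma error_second_moment k i :
  L1 (fun w => sqn (e k i w)) /\ E (fun w => sqn (e k i w)) <= gamma ^+ 2 * Delta ^+ 2.
Proof.
case: k => [|k].
  have -> : (fun w => sqn (e 0 i w)) = fun=> 0.
    by apply/funext => w; rewrite /= -(scale0r (0 : 'rV[R]_d)) dotvZl mul0r.
  by split; [exact: L1_cst|rewrite E_cst mulr_ge0 ?sqr_ge0].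
have [D0 _ cQ] := hcomp.
pose u := ec_arg comp gamma g xi k i.
pose h (p : borel_rV R d * S) : R := sqn (comp p.2 p.1 - p.1).
have mu' : measurable_fun [set: T] (u : T -> borel_rV R d).
  by apply: measurable_rVZ; apply: measurable_rVD => //; exact: measurable_rVZ.
have mh : measurable_fun [set: borel_rV R d * S] h.
  suff mc : measurable_fun [set: borel_rV R d * S]
      (fun p => comp p.2 p.1 - p.1 : borel_rV R d).
    exact: (measurable_dotv mc mc).
  apply: measurable_rVB => //.
  apply: (@measurableT_comp _ _ _ _ _ _ _ _
    (fun p : borel_rV R d * S => (p.2, p.1)) mcomp).
  exact: measurable_fun_pair.
have hQ v : (\int[Q]_s (h (v, s))%:E <= (Delta ^+ 2)%:E)%E.
  have := cQ v; rewrite unlock; under eq_integral do rewrite enorm_sqr.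
  by [].
pose uxi w : borel_rV R d * S := (u w, xi k i w).
have muxi : measurable_fun [set: T] uxi.
  exact: measurable_fun_pair.
have [|||ih Eh] := @ge0_L1 _ _ _ P (fun w => h (u w, xi k i w)) (Delta ^+ 2).
- exact: (measurableT_comp mh muxi).
- by move=> w; exact: dotvv_ge0.
- by apply: (@indep_integral_le _ _ _ T (borel_rV R d) S R P Q u (xi k i) h) => //;
  [exact: ec_seed_fresh hrand k i|exact: ec_seed_law hrand k i|move=> p; exact: dotvv_ge0].
have -> : (fun w => sqn (e k.+1 i w)) = fun w => gamma ^+ 2 * h (u w, xi k i w).
  apply/funext => w; rewrite /h /= /ec_message -/(ec_arg comp gamma g xi k i w) -/u.
  have -> : e k i w + gamma *: g k i w = gamma *: u w.
    by rewrite scalerA mulfV ?gt_eqF // scale1r.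
  rewrite -/(u w); move: (u w) (comp _ _) => a b.
  by rewrite -scalerBr dotvZl dotvZr dotvBB dotvBB (dotvC a); ring.
by split; [exact: L1Z|rewrite RintegralZl // ler_wpM2l ?sqr_ge0].
Qed.

Lemma ebar_second_moment k :
  L1 (fun w => sqn (ebar k w)) /\ E (fun w => sqn (ebar k w)) <= gamma ^+ 2 * Delta ^+ 2.
Proof.
have n0 : 0 < n%:R :> R by rewrite ltr0n.
have iS : L1 (fun w => n%:R^-1 * \sum_i sqn (e k i w)).
  by apply: L1Z; apply: L1_sum => i; have [] := error_second_moment k i.
have le_ w : sqn (ebar k w) <= n%:R^-1 * \sum_i sqn (e k i w) by exact: dotv_average_le.
have ie : L1 (fun w => sqn (ebar k w)).
  apply: L1_le iS => [|w]; first exact: measurable_dotv.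
  by rewrite ger0_norm ?dotvv_ge0.
split=> //; apply: le_trans (E_le ie iS le_) _.
rewrite RintegralZl //; last by apply: L1_sum => i; have [] := error_second_moment k i.
rewrite E_sum => [|i]; last by have [] := error_second_moment k i.
rewrite ler_pdivrMl //.
apply: le_trans (ler_sum _ (fun i _ => (error_second_moment k i).2)) _.
by rewrite sumr_const card_ord mulr_natl.
Qed.

Let sqgrad_le v : sqn (gradient f v) <= L ^+ 2 * sqn (v - xs).
Proof.
have [L0 sm] := hsmooth.
have := sm v xs; rewrite (gradient_min df hsmooth fmin) subr0 => h.
rewrite -!enorm_sqr -exprMn ler_sqr ?nnegrE ?mulr_ge0 ?enorm_ge0 //.
Qed.

Let rho_gt0 : 0 < rho. Proof. by have /andP[] := kpa_rho hkpa. Qed.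
Let rho_le1 : rho <= 1. Proof. by have /andP[] := kpa_rho hkpa. Qed.
Let F_ge0 : 0 <= F.
Proof. by apply: divr_ge0; apply: mulr_ge0 => //; [exact: kpa_B hkpa|exact: ltW]. Qed.
(** The reason for the value of [F]: the noise term B sigma^2 uses up three quarters of the
    contraction rho, leaving the rho / 4 that appears in eta. *)
Let BE : B = 3 / 4 * rho * F.
Proof. by rewrite /F; field; rewrite gt_eqF. Qed.

Definition lyapunov k : R :=
  E (fun w => sqn (y k w)) + gamma ^+ 2 * E (fun w => F * sigma2 k w).

(** Since x - xs = y + ebar, |x - xs|^2 <= 2 |y|^2 + 2 |ebar|^2, and smoothness bounds the gap by L
    / 2 times this. *)
Lemma gap_integrable k : L1 (fun w => sqn (y k w)) ->
  L1 (fun w => sqn (x k w - xs)) /\ L1 (gap k).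
Proof.
move=> iy; have [ie _] := ebar_second_moment k.
have ix : L1 (fun w => sqn (x k w - xs)).
  apply: L1_le (L1D (L1Z 2 iy) (L1Z 2 ie)) => [|w].
    apply: (@measurable_dotv _ _ _ _ (fun w => x k w - xs) (fun w => x k w - xs));
    by apply: measurable_rVB => //; exact: measurable_cst.
  rewrite ger0_norm ?dotvv_ge0 //.
  have -> : x k w - xs = y k w + ebar k w by rewrite /y addrAC subrK.
  exact: dotvDD_le.
split=> //; apply: L1_le (L1Z (L / 2) ix) => // w.
by rewrite ger0_norm //; exact: gap_le.
Qed.

Lemma second_moment_bound k : L1 (fun w => sqn (y k w)) ->
  L1 (fun w => F * sigma2 k w) ->
  L1 (fun w => sqn (mean_grad g k w)) /\
  E (fun w => sqn (mean_grad g k w)) <=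
    2 * A * E (gap k) + 3 / 4 * rho * E (fun w => F * sigma2 k w) + D1.
Proof.
move=> iy iS; have [_ ig] := gap_integrable iy.
have := kpa_second_moment hkpa k.
have -> : (fun w => enorm (mean_grad g k w) ^+ 2) = (fun w => sqn (mean_grad g k w)).
  by apply/funext => w; rewrite enorm_sqr.
have -> : (fun w => 2 * A * (f (x k w) - f xs) + B * sigma2 k w + D1) =
   (fun w => 2 * A * gap k w + 3 / 4 * rho * (F * sigma2 k w) + D1).
  by apply/funext => w; rewrite /gap BE; ring.
have i1 := L1Z (2 * A) ig; have i2 := L1Z (3 / 4 * rho) iS.
have i12 := L1D i1 i2; have i3 := L1D i12 (L1_cst P D1).
have A0 := kpa_A hkpa; have D10 := kpa_D1 hkpa.
move=> /(condexp_le_E (sG k) (Gm (k := k)))[||//|iG le1].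
- by move=> w; exact: dotvv_ge0.
- move=> w; have h1 := mulr_ge0 A0 (gap_ge0 k w).
  have h2 := mulr_ge0 (ltW rho_gt0) (mulr_ge0 F_ge0 (kpa_sigma2_ge0 hkpa k w)).
  by lra.
split=> //; apply: le_trans le1 _.
rewrite (RintegralD measurableT i12 (L1_cst P D1)) (RintegralD measurableT i1 i2).
by rewrite (RintegralZl _ measurableT ig) (RintegralZl _ measurableT iS) E_cst.
Qed.

(* When F = 0 nothing is known about the integrability of sigma2 itself, hence
   the factor F throughout. *)
Lemma sigma2_bound k : L1 (fun w => sqn (y k w)) ->
  L1 (fun w => F * sigma2 k w) ->
  L1 (fun w => F * sigma2 k.+1 w) /\
  E (fun w => F * sigma2 k.+1 w) <=
    (1 - rho) * E (fun w => F * sigma2 k w) + 2 * (C * F) * E (gap k) + F * D2.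
Proof.
move=> iy iS; have [_ ig] := gap_integrable iy.
have [F0|Fn0] := eqVneq F 0.
  have z j : (fun w => F * sigma2 j w) = fun=> 0.
    by apply/funext => w; rewrite F0 mul0r.
  rewrite !z E_cst F0; split; first exact: L1_cst.
  by rewrite !(mulr0, mul0r, addr0).
have Fp : 0 < F by rewrite lt_def Fn0.
have is2 : L1 (sigma2 k).
  by apply: eq_integrable (L1Z F^-1 iS) => // w _ /=; rewrite mulKf.
have C0 := kpa_C hkpa; have D20 := kpa_D2 hkpa.
have i1 := L1Z (1 - rho) is2; have i2 := L1Z (2 * C) ig.
have i12 := L1D i1 i2; have i3 := L1D i12 (L1_cst P D2).
have := kpa_sigma2_rec hkpa k.
move=> /(condexp_le_E (sG k) (Gm (k := k)))[||//|iG le1].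
- by move=> w; exact: kpa_sigma2_ge0 hkpa _ _.
- move=> w; have h1 := mulr_ge0 C0 (gap_ge0 k w).
  have rho1 : 0 <= 1 - rho by rewrite subr_ge0.
  by have h2 := mulr_ge0 rho1 (kpa_sigma2_ge0 hkpa k w); rewrite -/(gap k w); lra.
split; first exact: L1Z.
have -> : 2 * (C * F) * E (gap k) = F * (2 * C * E (gap k)) by ring.
rewrite !RintegralZl // mulrCA -!mulrDr ler_pM2l //.
apply: le_trans le1 _.
rewrite (RintegralD measurableT i12 (L1_cst P D2)) (RintegralD measurableT i1 i2).
by rewrite !RintegralZl // E_cst.
Qed.

(** Conditioning is done coordinate by coordinate, as unbiasedness is stated. All factors are square
    integrable, the gradient because it is Lipschitz and vanishes at [xs], so every product is
    integrable. *)
Lemma cross_term k : L1 (fun w => sqn (y k w)) ->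
  L1 (fun w => sqn (mean_grad g k w)) ->
  [/\ L1 (fun w => dotv (mean_grad g k w) (y k w)),
     L1 (fun w => dotv (gradient f (x k w)) (y k w)) &
  E (fun w => dotv (mean_grad g k w) (y k w)) =
  E (fun w => dotv (gradient f (x k w)) (y k w))].
Proof.
move=> iy ig; have [ix _] := gap_integrable iy.
have coord_le (v : 'rV[R]_d) j : v 0 j ^+ 2 <= sqn v.
  rewrite /dotv (bigD1 j) //= -expr2 lerDl sumr_ge0 // => i _.
  by rewrite -expr2 sqr_ge0.
have coord2 (X : T -> 'rV[R]_d) j : measurable_fun [set: T] (fun w => X w 0 j) ->
    L1 (fun w => sqn (X w)) -> L1 (fun w => X w 0 j ^+ 2).
  move=> mX iX; apply: L1_le iX => [|w]; first exact: measurable_funX.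
  by rewrite ger0_norm ?sqr_ge0.
have my j : measurable_fun [set: T] (fun w => y k w 0 j).
  exact: (measurable_rVP _).1 (y_measurable k) j.
have mg j : measurable_fun [set: T] (fun w => mean_grad g k w 0 j).
  exact: (measurable_rVP _).1 (mean_grad_measurable k) j.
(* Measurability of the gradient is read off from its being a version of a conditional
   expectation. *)
have mgrad j : measurable_fun [set: T] (fun w => gradient f (x k w) 0 j).
  have [_ _ mY _] := kpa_unbiased hkpa k j.
  apply/measurable_EFinP; exact: measurable_wrt_fun (Gm (k := k)) mY.
have grad2 j : L1 (fun w => gradient f (x k w) 0 j ^+ 2).
  apply: L1_le (L1Z (L ^+ 2) ix) => [|w]; first exact: measurable_funX.
  by rewrite ger0_norm ?sqr_ge0 //; apply: le_trans (coord_le _ _) (sqgrad_le _).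
have y2 j := coord2 _ j (my j) iy.
have g2 j := coord2 _ j (mg j) ig.
have igy j : L1 (fun w => mean_grad g k w 0 j * y k w 0 j) by exact: L2_mul.
have igry j : L1 (fun w => gradient f (x k w) 0 j * y k w 0 j) by exact: L2_mul.
split; [exact: L1_sum|exact: L1_sum|].
rewrite !E_sum //; apply: eq_bigr => j _.
have comm (X : T -> 'rV[R]_d) : (fun w => X w 0 j * y k w 0 j) = (fun w => y k w 0 j * X w 0 j).
  by apply/funext => w; rewrite mulrC.
rewrite (comm (mean_grad g k)) (comm (fun w => gradient f (x k w))).
apply: (condexp_mul (sG k) (Gm (k := k)) (kpa_unbiased hkpa k j)).
- exact: L2_L1.
- exact: L2_L1.
- apply/(measurable_wrtP _ (sG k)).
  exact: (measurable_rVP _).1 ((measurable_wrtP _ (sG k)).1 (y_adapted k)) j.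
- by rewrite -(comm (mean_grad g k)).
- by rewrite -(comm (fun w => gradient f (x k w))).
Qed.

(** Integrability at [k.+1] is part of the conclusion, so an induction on [k] can carry it along
    with the inequality. *)
Lemma lyapunov_step k (eta : R) : L1 (fun w => sqn (y k w)) ->
  L1 (fun w => F * sigma2 k w) ->
  eta <= gamma * mu / 2 -> eta <= rho / 4 -> gamma * (A + C * F) <= 1 / 4 ->
  [/\ L1 (fun w => sqn (y k.+1 w)), L1 (fun w => F * sigma2 k.+1 w) &
   lyapunov k.+1 <= (1 - eta) * lyapunov k - gamma / 2 * E (gap k)
     + gamma ^+ 2 * (D1 + F * D2 + 3 * L * gamma * Delta ^+ 2)].
Proof.
move=> iy iS eta1 eta2 gam.
have [ix igap] := gap_integrable iy.
have [ig Eg] := second_moment_bound iy iS.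
have [is1 Es1] := sigma2_bound iy iS.
have [igy igrady Ecross] := cross_term iy ig.
have [ie Ee] := ebar_second_moment k.
have yE w : sqn (y k.+1 w) = sqn (y k w)
    + ((- 2 * gamma) * dotv (mean_grad g k w) (y k w) + gamma ^+ 2 * sqn (mean_grad g k w)).
  by rewrite y_succ; move: (y k w) (mean_grad g k w) => a b;
    rewrite dotvBB dotvZl !dotvZr (dotvC a); ring.
have i1 := L1Z (- 2 * gamma) igy; have i2 := L1Z (gamma ^+ 2) ig.
have i3 := L1D i1 i2.
have yE' : (fun w => sqn (y k.+1 w)) = (fun w => sqn (y k w)
    + ((- 2 * gamma) * dotv (mean_grad g k w) (y k w) + gamma ^+ 2 * sqn (mean_grad g k w))).
  exact/funext.
have iy1 : L1 (fun w => sqn (y k.+1 w)) by rewrite yE'; exact: L1D.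
split=> //.
have Ey : E (fun w => sqn (y k.+1 w)) = E (fun w => sqn (y k w))
   + ((- 2 * gamma) * E (fun w => dotv (gradient f (x k w)) (y k w))
     + gamma ^+ 2 * E (fun w => sqn (mean_grad g k w))).
  by rewrite yE' RintegralD // RintegralD // !RintegralZl // Ecross.
have Edesc : E (gap k) + mu / 2 * E (fun w => sqn (y k w))
    - 3 * L * E (fun w => sqn (ebar k w)) <=
  2 * E (fun w => dotv (gradient f (x k w)) (y k w)).
  have j1 := L1Z (mu / 2) iy; have j2 := L1Z (3 * L) ie; have j3 := L1D igap j1.
  rewrite -!RintegralZl // -RintegralD // -RintegralB //.
  apply: E_le; [exact: L1B|exact: L1Z|move=> w].
  exact: virtual_descent.
have L0 : 0 <= L by case: hsmooth.
have y0 : 0 <= E (fun w => sqn (y k w)) by apply: E_ge0 => w; exact: dotvv_ge0.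
have s0 : 0 <= E (fun w => F * sigma2 k w).
  by apply: E_ge0 => w; rewrite mulr_ge0 // (kpa_sigma2_ge0 hkpa).
have p0 : 0 <= E (gap k) by exact: E_ge0.
rewrite /lyapunov Ey.
move: Edesc Eg Es1 Ee y0 s0 p0.
set Y := E (fun w => sqn (y k w)); set Gr := E (fun w => dotv (gradient f _) _).
set Ge := E (fun w => sqn (mean_grad g k w)); set S1 := E (fun w => F * sigma2 k.+1 w).
set S0 := E (fun w => F * sigma2 k w); set Ph := E (gap k).
set Eb := E (fun w => sqn (ebar k w)).
exact: (lyapunov_arith (ltW hgamma0) L0).
Qed.

Lemma y_init w : y 0%N w = x0 - xs.
Proof.
by rewrite /y /ebar /average /= big1 // scaler0 subr0.
Qed.

Lemma lyapunov_init : L1 (fun w => F * sigma2 0%N w) ->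
  lyapunov 0 = E (fun w => enorm (x0 - xs) ^+ 2 + F * gamma ^+ 2 * sigma2 0%N w).
Proof.
move=> iS; rewrite /lyapunov.
have -> : (fun w => sqn (y 0%N w)) = fun=> enorm (x0 - xs) ^+ 2.
  by apply/funext => w; rewrite y_init enorm_sqr.
have -> : (fun w => enorm (x0 - xs) ^+ 2 + F * gamma ^+ 2 * sigma2 0%N w) =
    fun w => enorm (x0 - xs) ^+ 2 + gamma ^+ 2 * (F * sigma2 0%N w).
  by apply/funext => w; rewrite mulrA (mulrC F).
rewrite (RintegralD measurableT (L1_cst P _) (L1Z _ iS)).
by rewrite (RintegralZl _ measurableT iS) E_cst.
Qed.

(** Common to both rates, which differ only in how the total weight [W] is then evaluated. *)
Lemma ec_sgd_bound (eta : R) (K : nat) :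
  convex_function (setT : set (convex_lmodType 'rV[R]_d)) f ->
  eta <= gamma * mu / 2 -> eta <= rho / 4 -> gamma * (A + C * F) <= 1 / 4 ->
  L1 (fun w => F * sigma2 0%N w) ->
  let W := \sum_(k < K.+1) weight eta k in
  let xbar w := weighted_average eta (fun k => x k w) K in
  L1 (fun w => f (xbar w) - f xs) /\
  E (fun w => f (xbar w) - f xs) <= W^-1 * (2 * lyapunov 0 * gamma^-1)
    + 2 * gamma * (D1 + F * D2 + 3 * L * gamma * Delta ^+ 2).
Proof.
move=> cf eta1 eta2 gam iS0 W xbar.
have etalt1 : eta < 1 by have := rho_le1; lra.
have w0 k : 0 < weight eta k by rewrite invr_gt0 exprn_gt0 // subr_gt0.
have W0 : 0 < W by rewrite /W big_ord_recl ltr_wpDr // sumr_ge0 // => k _; exact: ltW.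
have L1k k : L1 (fun w => sqn (y k w)) /\ L1 (fun w => F * sigma2 k w).
  elim: k => [|k [iy iS]].
    split=> //; rewrite (_ : (fun w => _) = fun=> sqn (x0 - xs)); first exact: L1_cst.
    by apply/funext => w; rewrite y_init.
  by have [] := lyapunov_step iy iS eta1 eta2 gam.
have igap k : L1 (gap k) by have [iy _] := L1k k; have [] := gap_integrable iy.
have rec k : lyapunov k.+1 <= (1 - eta) * lyapunov k - gamma / 2 * E (gap k)
     + gamma ^+ 2 * (D1 + F * D2 + 3 * L * gamma * Delta ^+ 2).
  by have [iy iS] := L1k k; have [] := lyapunov_step iy iS eta1 eta2 gam.
set c := D1 + F * D2 + 3 * L * gamma * Delta ^+ 2 in rec *.
have := weighted_telescope K.+1 etalt1 rec.
(* The final Lyapunov term is nonnegative and gets dropped from the telescoped sum. *)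
have : 0 <= (1 - eta) ^- K.+1 * lyapunov K.+1.
  apply: mulr_ge0; first exact: ltW (w0 K).
  apply: addr_ge0; first by apply: E_ge0 => w; exact: dotvv_ge0.
  apply: mulr_ge0; first exact: sqr_ge0.
  by apply: E_ge0 => w; apply: mulr_ge0 => //; exact: kpa_sigma2_ge0 hkpa _ _.
rewrite -/W => l0 tel.
have jensen w : f (xbar w) - f xs <= W^-1 * \sum_(k < K.+1) weight eta k * gap k w.
  have := jensen_weighted (fun k => x k w) K cf w0; rewrite -/W => h.
  have -> : \sum_(k < K.+1) weight eta k * gap k w =
      \sum_(k < K.+1) weight eta k * f (x k w) - W * f xs.
    rewrite /W mulr_suml -sumrB; apply: eq_bigr => k _; exact: mulrBr.
  by rewrite mulrBr mulKf ?gt_eqF // lerD2r.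
have iw (k : 'I_K.+1) : L1 (fun w => weight eta k * gap k w) by exact: L1Z.
have iSum := L1_sum (index_enum 'I_K.+1) iw.
have iSumW := L1Z W^-1 iSum.
have mbar : measurable_fun [set: T] (xbar : T -> borel_rV R d).
  apply: measurable_rVZ; apply: (@measurable_rV_sum R d _ T _ _
    (fun (k : 'I_K.+1) w => weight eta k *: x k w)) => k.
  exact: measurable_rVZ.
have ibar : L1 (fun w => f (xbar w) - f xs).
  apply: L1_le iSumW => [|w].
    apply: measurable_funB => //.
    apply: (measurableT_comp (continuous_measurable_rV _) mbar).
    by move=> v; apply: differentiable_continuous.
  by rewrite ger0_norm ?subr_ge0.
split=> //; apply: le_trans (E_le ibar iSumW jensen) _.
rewrite (RintegralZl _ measurableT iSum) (E_sum _ iw).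
rewrite (eq_bigr (fun k : 'I_K.+1 => weight eta k * E (gap k))); last first.
  by move=> k _; rewrite (RintegralZl _ measurableT (igap k)).
rewrite ler_pdivrMl // mulrDr mulrA mulfV ?gt_eqF // mul1r.
move: tel l0; set Sg := \sum_(k < K.+1) _; set l1 := _ * lyapunov K.+1; set t0 := lyapunov 0.
move=> tel l0.
have g0 : 0 < gamma^-1 by rewrite invr_gt0.
have h : gamma / 2 * Sg <= t0 + gamma ^+ 2 * c * W by lra.
(* The factor 2 / gamma clears gamma / 2 and turns gamma^2 c into 2 gamma c. *)
have := ler_wpM2l (mulr_ge0 (ler0n R 2) (ltW g0)) h.
have -> : 2 * gamma^-1 * (gamma / 2 * Sg) = Sg by field; rewrite gt_eqF.
have -> : 2 * gamma^-1 * (t0 + gamma ^+ 2 * c * W) = 2 * t0 * gamma^-1 + W * (2 * gamma * c).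
  by field; rewrite gt_eqF.
by [].
Qed.

End ec_sgd.

(** * The two convergence rates *)

Theorem theorem2p2 (R : realType) (n d : nat) (hn : (0 < n)%N)
  (dT dS : measure_display) (T : measurableType dT) (S : measurableType dS)
  (P : probability T R) (Q : probability S R)
  (f_ : 'I_n -> 'rV[R]_d -> R) (f : 'rV[R]_d -> R) (hf : f = avg_fun f_)
  (hdiff : forall i x, differentiable (f_ i) x)
  (xs : 'rV[R]_d) (hxs : is_unique_minimizer f xs)
  (mu L : R) (hmu : 0 <= mu)
  (hconv : convex_function (setT : set (convex_lmodType 'rV[R]_d)) f)
  (hqsc : quasi_strongly_convex mu f xs) (hsmooth : smooth L f)
  (comp : S -> 'rV[R]_d -> 'rV[R]_d) (Delta : R)
  (hcomp : absolute_compressor Q comp Delta)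
  (gamma : R) (x0 : 'rV[R]_d)
  (g : nat -> 'I_n -> T -> 'rV[R]_d) (xi : nat -> 'I_n -> T -> S)
  (Fk : nat -> set (set T))
  (hrand : ec_sgd_randomness comp gamma g xi P Q Fk)
  (sigma2 : nat -> T -> R) (A B C D1 D2 rho : R)
  (hkpa : key_parametric_assumption P Fk f xs
            (ec_iter comp gamma x0 g xi) (mean_grad g) sigma2
            A B C D1 D2 rho)
  (F : R) (hF : F = 4 * B / (3 * rho))
  (hgamma0 : 0 < gamma)
  (hgamma : A + C * F != 0 -> gamma <= 1 / (4 * (A + C * F)))
  (eta : R) (heta : eta = Num.min (gamma * mu / 2) (rho / 4))
  (T0 : T -> R)
  (hT0 : T0 = fun w => enorm (x0 - xs) ^+ 2 + F * gamma ^+ 2 * sigma2 0%N w)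
  (K : nat) :
  let xbar := fun w =>
    weighted_average eta (fun k => ec_iter comp gamma x0 g xi k w) K in
  let err := 2 * gamma * (D1 + F * D2 + 3 * L * gamma * Delta ^+ 2) in
  (0 < mu ->
    ('E_P[fun w => (f (xbar w) - f xs)%R]
       <= ((1 - eta) ^+ K.+1)%:E * (2%:E * 'E_P[T0] * (gamma^-1)%:E)
          + err%:E)%E) /\
  (mu = 0 ->
    ('E_P[fun w => (f (xbar w) - f xs)%R]
       <= 2%:E * 'E_P[T0] * ((gamma * K.+1%:R)^-1)%:E + err%:E)%E).
Proof.
move=> xbar err.
have df x : differentiable f x by rewrite hf; exact: differentiable_avg_fun.
have [fmin _] := hxs.
have [rho0 rho1] := andP (kpa_rho hkpa).
have eta1 : eta <= gamma * mu / 2 by rewrite heta ge_min lexx.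
have eta2 : eta <= rho / 4 by rewrite heta ge_min lexx orbT.
have etalt1 : eta < 1 by lra.
have F0 : 0 <= F.
  rewrite hF; apply: divr_ge0; apply: mulr_ge0 => //; [exact: kpa_B hkpa|exact: ltW].
have AC0 : 0 <= A + C * F.
  by apply: addr_ge0; [exact: kpa_A hkpa|apply: mulr_ge0 => //; exact: kpa_C hkpa].
have gam : gamma * (A + C * F) <= 1 / 4.
  (* If A + C F = 0 the stepsize is unrestricted, and the product form of the condition holds
     trivially. *)
  have [->|ACn0] := eqVneq (A + C * F) 0; first by rewrite mulr0 divr_ge0.
  have ACp : 0 < A + C * F by rewrite lt_def ACn0.
  have := ler_wpM2r AC0 (hgamma ACn0).
  rewrite (_ : 1 / (4 * (A + C * F)) * (A + C * F) = 1 / 4) //.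
  by field; rewrite gt_eqF.
have bound := ec_sgd_bound hn df fmin hmu hqsc hsmooth hcomp hrand hkpa
  hgamma0 K hconv eta1 eta2.
have T00 w : 0 <= T0 w.
  rewrite hT0; apply: addr_ge0; first exact: sqr_ge0.
  apply: mulr_ge0; last exact: kpa_sigma2_ge0 hkpa _ _.
  by apply: mulr_ge0 => //; exact: sqr_ge0.
have Fm := ec_sub_measurable hrand.
have mT0 : measurable_fun [set: T] T0.
  rewrite hT0; apply: measurable_funD => //; apply: measurable_funM => //.
  exact: measurable_wrt_fun (Fm 0%N) (kpa_sigma2_adapted hkpa 0%N).
rewrite unlock.
set ET0 := (\int[P]_w (T0 w)%:E)%E.
have ET00 : (0 <= ET0)%E by apply: integral_ge0 => w _; rewrite lee_fin.
have [ET0oo|ET0fin] := eqVneq ET0 +oo%E.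
  rewrite ET0oo; split => _.
    rewrite gt0_muley ?lte_fin // gt0_mulye ?lte_fin ?invr_gt0 //.
    by rewrite gt0_muley ?lte_fin ?exprn_gt0 ?subr_gt0 // addye ?leey.
  by rewrite gt0_muley ?lte_fin // gt0_mulye ?lte_fin ?invr_gt0 ?mulr_gt0 // addye ?leey.
have ET0E : ET0 = (fine ET0)%:E by rewrite fineK // ge0_fin_numE // ltey.
have [iT0 _] : P.-integrable [set: T] (EFin \o T0) /\ \int[P]_w T0 w <= fine ET0.
  by apply: ge0_L1 => //; rewrite -ET0E.
have iS0 : P.-integrable [set: T] (EFin \o (fun w => 4 * B / (3 * rho) * sigma2 0%N w)).
  (* F sigma_0^2 is recovered from [T0] by removing the constant and dividing by gamma^2. *)
  apply: eq_integrable (L1Z (gamma ^- 2) (L1B iT0 (L1_cst P (enorm (x0 - xs) ^+ 2)))) => //.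
  move=> w _; rewrite /= hT0 -hF; congr (_%:E).
  rewrite addrAC subrr add0r (mulrC F) -mulrA mulKf //.
  by rewrite expf_neq0 // gt_eqF.
have := bound; rewrite -hF => /(_ gam) => {}bound.
have lE := lyapunov_init xs comp gamma x0 g xi iS0.
rewrite -hF in iS0 lE; have [ibar lebar] := bound iS0.
rewrite lE -/err in lebar.
have vE : \int[P]_w (enorm (x0 - xs) ^+ 2 + F * gamma ^+ 2 * sigma2 0%N w) = fine ET0.
  by rewrite /ET0 hT0.
rewrite vE in lebar; have v0 : 0 <= fine ET0 by exact: fine_ge0.
rewrite E_EFin // ET0E -!EFinM -!EFinD !lee_fin.
split => [mu0|mu0]; apply: le_trans lebar _; rewrite lerD2r.
  apply: ler_wpM2r.
    by rewrite !mulr_ge0 // invr_ge0 ltW.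
  have q0 : 0 < (1 - eta) ^+ K.+1 by rewrite exprn_gt0 // subr_gt0.
  (* The total weight is at least its last term. *)
  have qW : ((1 - eta) ^+ K.+1)^-1 <= \sum_(k < K.+1) weight eta k.
    rewrite big_ord_recr /= lerDr sumr_ge0 // => k _.
    by rewrite invr_ge0 exprn_ge0 // subr_ge0 ltW.
  rewrite -[leRHS]invrK lef_pV2 ?posrE ?invr_gt0 //.
  by apply: lt_le_trans qW; rewrite invr_gt0.
(* For mu = 0 the minimum is its first entry, so all weights are 1 and their sum is K + 1. *)
have eta0 : eta = 0.
  by rewrite heta mu0 mulr0 mul0r; apply: min_idPl; rewrite divr_ge0 // ltW.
have -> : \sum_(k < K.+1) weight eta k = K.+1%:R.
  rewrite (eq_bigr (fun=> 1)) => [|k _]; last by rewrite /weight eta0 subr0 expr1n invr1.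
  by rewrite sumr_const card_ord.
by rewrite invfM mulrC mulrA.
Qed.
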